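(* For every complex $s$ with $|s|<2$, $$\frac{1}{\pi}\int_{\mathbb{D}}|x+1|^s\,dA(x)=\exp\left(\sum_{j=2}^\infty \frac{(-1)^{j}}{j} (1-2^{1-j})(\zeta(j)-1)s^j\right).$$ Equivalently, $\frac{1}{\pi}\int_{\mathbb{D}}|x+1|^s\,dA(x)=\frac{s+1}{(s/2+1)^2}\cdot\frac{\Gamma(s+1)}{\Gamma(s/2+1)^2}$.
   Context: $\mathbb{D}=\{x\in\mathbb{C}:|x|\le 1\}$ and $dA$ is Lebesgue (area) measure on $\mathbb{C}$; $\zeta$ is the Riemann zeta function and $\Gamma$ the Gamma function. The left side is the areal zeta Mahler measure $Z_\mathbb{D}(s,x+1)$. *)

(* Defs.v *)
From HB Require Import structures.
From mathcomp Require Import all_boot all_order all_algebra.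
From mathcomp Require Import all_classical all_reals all_analysis.
From mathcomp Require complex.
Import complex.ComplexField.
Set Implicit Arguments. Unset Strict Implicit. Unset Printing Implicit Defensive.
Import Order.TTheory GRing.Theory Num.Theory.
Local Open Scope classical_set_scope.
Local Open Scope ring_scope.

Definition zeta_nat (R : realType) (j : nat) : R :=
  limn (fun N => \sum_(1 <= n < N) ((n%:R : R) ^+ j)^-1).

(* Lebesgue (area) measure on C identified with R x R via x = u + i v. *)
Definition areaR (R : realType) :=
  ((@lebesgue_measure R) \x (@lebesgue_measure R))%E.

Definition diskR (R : realType) : set (R * R) :=
  [set p | p.1 ^+ 2 + p.2 ^+ 2 <= 1].

Definition log_abs_xp1 (R : realType) (p : R * R) : R :=
  ln (Num.sqrt ((p.1 + 1) ^+ 2 + p.2 ^+ 2)).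

(* |x+1|^s = exp(s log|x+1|) for s = a + i b: real and imaginary parts. *)
Definition pow_re (R : realType) (a b : R) (p : R * R) : R :=
  expR (a * log_abs_xp1 p) * cos (b * log_abs_xp1 p).
Definition pow_im (R : realType) (a b : R) (p : R * R) : R :=
  expR (a * log_abs_xp1 p) * sin (b * log_abs_xp1 p).

Definition coef (R : realType) (j : nat) : R :=
  (-1) ^+ j / j%:R * (1 - (2 ^+ j.-1)^-1) * (zeta_nat R j - 1).

Definition term (R : realType) (s : complex.complex R) (j : nat) : complex.complex R :=
  complex.real_complex_def (Phant R) (coef R j) * s ^+ j.

Definition S_re (R : realType) (s : complex.complex R) : R :=
  limn (fun N => \sum_(2 <= j < N) complex.Re (term s j)).
Definition S_im (R : realType) (s : complex.complex R) : R :=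
  limn (fun N => \sum_(2 <= j < N) complex.Im (term s j)).

(* Main.v *)
(* Write x = u + i v, w = 1 - |x|^2, h = s/2 and
   J_k(s) = (k+1)/pi * int_D w^k |1+x|^s dA.  Integrating over the disk the
   divergences of the fields w^(k+1) |1+x|^s x and w^(k+2) |1+x|^(s-2) (1+x),
   which vanish on the boundary, and eliminating int_D w^(k+2) |1+x|^(s-2) dA gives
   (1 + s/n) J_(n-2) = (1 + h/n)^2 J_(n-1) for n >= 2.  (This is Gauss'
   contiguity relation for 2F1(-h, -h; n; 1).)  The probability measures
   (k+1)/pi w^k dA concentrate at 0, so J_k(s) tends to 1 and J_0(s) is the infinite
   product of (1 + h/n)^2 / (1 + s/n) over n >= 2.  Expanding the logarithms of the
   factors for |s| < 2 and exchanging the sums over n and j gives the series with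
   coefficients (-1)^j/j (1 - 2^(1-j)) (zeta(j) - 1). *)

Require Import Defs.
From HB Require Import structures.
From mathcomp Require Import all_boot all_order all_algebra.
From mathcomp Require Import all_classical all_reals all_analysis.
From mathcomp Require Import measurable_realfun.
From mathcomp Require Import zify ring lra.
From mathcomp Require complex.
Import complex.ComplexField.
Import Order.TTheory GRing.Theory Num.Theory.
Import numFieldNormedType.Exports.
Local Open Scope classical_set_scope.
Local Open Scope ring_scope.

(** The boundary point x = -1, where |1+x| vanishes, shapes the proof: |1+x|^s may be unbounded
    there, and the second field carries |1+x|^(s-2). On the disk w^2 <= 4 |1+x|^2, so the powers of
    w absorb |1+x|^-2, and every integrand is a bounded function times O(|1+x|^al) with -2 < al <=
    0. Both divergence identities come from the one-variable fundamental theorem on horizontal and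
    vertical slices, followed by Fubini; almost every slice avoids x = -1. Writing |1+x|^s as
    phi(log |1+x|), they are linear in phi and psi = phi', so they are proved for real phi and used
    for the real and imaginary parts of exp(s x); phi = 1 yields the normalisation of w^k dA. No
    branch of the logarithm is chosen: for |z| < 1, 1 + z is the exponential of the sum of its
    Mercator series, and only exponentials of sums of such series occur. *)

Section Complex.
Variable R : realType.
Local Notation C := (complex.complex R).
Local Notation Re := (@complex.Re R).
Local Notation Im := (@complex.Im R).
Local Notation "x %:C" := (complex.real_complex_def (Phant R) x) (at level 2, format "x %:C").
Local Notation nc := (@Normc.normc R).

(** * Componentwise complex arithmetic *)

Lemma Re_addc (x y : C) : Re (x + y) = Re x + Re y. Proof. by case: x; case: y. Qed.
Lemma Im_addc (x y : C) : Im (x + y) = Im x + Im y. Proof. by case: x; case: y. Qed.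
Lemma Re_mulc (x y : C) : Re (x * y) = Re x * Re y - Im x * Im y.
Proof. by case: x; case: y. Qed.
Lemma Im_mulc (x y : C) : Im (x * y) = Re x * Im y + Im x * Re y.
Proof. by case: x; case: y. Qed.
Lemma complexP (x y : C) : Re x = Re y -> Im x = Im y -> x = y.
Proof. by case: x => a b; case: y => c d /= -> ->. Qed.
Lemma Re_sum (I : Type) (r : seq I) (P : pred I) (F : I -> C) :
  Re (\sum_(i <- r | P i) F i) = \sum_(i <- r | P i) Re (F i).
Proof. by apply: (big_morph Re Re_addc). Qed.
Lemma Im_sum (I : Type) (r : seq I) (P : pred I) (F : I -> C) :
  Im (\sum_(i <- r | P i) F i) = \sum_(i <- r | P i) Im (F i).
Proof. by apply: (big_morph Im Im_addc). Qed.
Lemma rcD (x y : R) : (x + y)%:C = x%:C + y%:C.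
Proof. by apply: complexP; rewrite ?Re_addc ?Im_addc/= ?addr0. Qed.
Lemma rcM (x y : R) : (x * y)%:C = x%:C * y%:C.
Proof. by apply: complexP; rewrite ?Re_mulc ?Im_mulc/=; ring. Qed.
Lemma rc0 : 0%:C = 0. Proof. by []. Qed.
Lemma rc1 : 1%:C = 1. Proof. by []. Qed.
Lemma rcN1 : (-1)%:C = -1.
Proof. by apply: complexP; rewrite /= ?oppr0. Qed.
Lemma rcX (x : R) n : (x ^+ n)%:C = x%:C ^+ n.
Proof. by elim: n => [//|n IH]; rewrite !exprS rcM IH. Qed.
Lemma normc_rc (x : R) : nc x%:C = `|x|.
Proof. by rewrite /= expr0n/= addr0 sqrtr_sqr. Qed.
Lemma normcX (z : C) n : nc (z ^+ n) = nc z ^+ n.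
Proof.
elim: n => [|n IH]; first exact: Normc.normc1.
by rewrite !exprS Normc.normcM IH.
Qed.
Lemma normcN (z : C) : nc (- z) = nc z.
Proof. by case: z => a b /=; rewrite !sqrrN. Qed.
Lemma normc_ge0 (z : C) : 0 <= nc z. Proof. by case: z => a b /=; exact: sqrtr_ge0. Qed.
Lemma Re_le (z : C) : `|Re z| <= nc z.
Proof.
case: z => a b /=; rewrite -sqrtr_sqr ler_wsqrtr// lerDl sqr_ge0//.
Qed.
Lemma Im_le (z : C) : `|Im z| <= nc z.
Proof.
case: z => a b /=; rewrite -sqrtr_sqr ler_wsqrtr// lerDr sqr_ge0//.
Qed.

(** * Complex exponential, derivatives in a real variable, partial sums of log(1 + z) *)

Definition cexp (z : C) : C :=
  complex.Complex (expR (Re z) * cos (Im z)) (expR (Re z) * sin (Im z)).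

Lemma cexpD z w : cexp (z + w) = cexp z * cexp w.
Proof.
apply: complexP; rewrite ?Re_mulc ?Im_mulc/= Re_addc Im_addc expRD ?cosD ?sinD; ring.
Qed.
Lemma cexp0 : cexp 0 = 1.
Proof. by apply: complexP; rewrite /= expR0 ?cos0 ?sin0; ring. Qed.
Lemma normc_cexp z : nc (cexp z) = expR (Re z).
Proof.
rewrite /= !exprMn -mulrDr cos2Dsin2 mulr1 sqrtr_sqr ger0_norm//; exact: expR_ge0.
Qed.

(** Taken by components along a real parameter, so that the real mean value theorem applies to each
    component. *)
Definition cderive (f : R -> C) (t : R) (d : C) :=
  is_derive t 1 (Re \o f) (Re d) /\ is_derive t 1 (Im \o f) (Im d).

Lemma cderiveD f g t df dg : cderive f t df -> cderive g t dg ->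
  cderive (fun x => f x + g x) t (df + dg).
Proof.
move=> [f1 f2] [g1 g2]; split.
  rewrite Re_addc (_ : _ \o _ = (Re \o f) + (Re \o g)); first exact: is_deriveD.
  by apply/funext => x; rewrite /= Re_addc.
rewrite Im_addc (_ : _ \o _ = (Im \o f) + (Im \o g)); first exact: is_deriveD.
by apply/funext => x; rewrite /= Im_addc.
Qed.

Lemma cderiveM f g t df dg : cderive f t df -> cderive g t dg ->
  cderive (fun x => f x * g x) t (df * g t + f t * dg).
Proof.
move=> [f1 f2] [g1 g2]; split.
  rewrite Re_addc !Re_mulc (_ : _ \o _ = (Re \o f) * (Re \o g) - (Im \o f) * (Im \o g)); last first.
    by apply/funext => x; rewrite /= Re_mulc.
  apply: is_derive_eq; rewrite /GRing.scale/=; ring.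
rewrite Im_addc !Im_mulc (_ : _ \o _ = (Re \o f) * (Im \o g) + (Im \o f) * (Re \o g)); last first.
  by apply/funext => x; rewrite /= Im_mulc.
apply: is_derive_eq; rewrite /GRing.scale/=; ring.
Qed.

Lemma cderive_cst z t : cderive (fun=> z) t 0.
Proof. by split; exact: is_derive_cst. Qed.

Lemma cderive_rc t : cderive (fun x => x%:C) t 1.
Proof. by split; [exact: is_derive_id|exact: is_derive_cst]. Qed.

Lemma cderive_cexp f t df : cderive f t df ->
  cderive (fun x => cexp (f x)) t (df * cexp (f t)).
Proof.
move=> [f1 f2]; split.
  rewrite (_ : _ \o _ = (expR \o (Re \o f)) * (cos \o (Im \o f)))//.
  have h1 := is_derive1_comp (is_derive_expR (Re (f t))) f1.
  have h2 := is_derive1_comp (is_derive_cos (Im (f t))) f2.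
  by apply: is_derive_eq; rewrite /GRing.scale/= Re_mulc/=; ring.
rewrite (_ : _ \o _ = (expR \o (Re \o f)) * (sin \o (Im \o f)))//.
have h1 := is_derive1_comp (is_derive_expR (Re (f t))) f1.
have h2 := is_derive1_comp (is_derive_sin (Im (f t))) f2.
by apply: is_derive_eq; rewrite /GRing.scale/= Im_mulc/=; ring.
Qed.

Lemma cderiveX f t df n : cderive f t df ->
  cderive (fun x => f x ^+ n) t (n%:R%:C * df * f t ^+ n.-1).
Proof.
move=> hf; elim: n => [|n IH].
  by rewrite rc0 !mul0r; exact: cderive_cst.
have := cderiveM _ _ _ _ _ hf IH.
rewrite (_ : _ + _ = n.+1%:R%:C * df * f t ^+ n).
  by move=> h; under eq_fun do rewrite exprS.
case: n {IH} => [|n] /=; first by rewrite rc0 rc1; ring.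
by rewrite -[n.+2]addn1 natrD rcD rc1 exprS; ring.
Qed.

(** Mercator partial sum of log(1 + z) with [J] terms. *)
Definition logpoly (z : C) (J : nat) : C :=
  \sum_(i < J) ((-1) ^+ i / i.+1%:R)%:C * z ^+ i.+1.

Lemma cderive_logpoly z J t :
  cderive (fun x => logpoly (x%:C * z) J) t
    (\sum_(i < J) z * (- (t%:C * z)) ^+ i).
Proof.
elim: J => [|J IH].
  rewrite big_ord0 /logpoly; under eq_fun do rewrite big_ord0; exact: cderive_cst.
rewrite big_ord_recr/= /logpoly; under eq_fun do rewrite big_ord_recr/=.
apply: cderiveD => //.
have h1 := cderiveM _ _ _ _ _ (cderive_rc t) (cderive_cst z t).
have h2 := cderiveM _ _ _ _ _ (cderive_cst ((-1) ^+ J / J.+1%:R)%:C t)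
  (cderiveX _ _ _ J.+1 h1).
rewrite (_ : z * _ = 0 * (t%:C * z) ^+ J.+1 +
  ((-1) ^+ J / J.+1%:R)%:C * (J.+1%:R%:C * (1 * z + t%:C * 0) * (t%:C * z) ^+ J.+1.-1))//.
rewrite mul0r add0r mulr0 addr0 mul1r/= !mulrA -rcM divfK ?pnatr_eq0//.
rewrite [in LHS]exprNn rcX rcN1; ring.
Qed.

Lemma geometric_sum_le (q : R) n : 0 <= q < 1 -> \sum_(i < n) q ^+ i <= (1 - q)^-1.
Proof.
move=> /andP[q0 q1]; rewrite -(ler_pM2l (_ : 0 < 1 - q)) ?subr_gt0//.
rewrite mulfV ?gt_eqF ?subr_gt0// -opprB mulNr -subrX1 opprB.
by rewrite gerBl exprn_ge0.
Qed.

Lemma normc_sum_le n (F : 'I_n -> C) (B : 'I_n -> R) : (forall i, nc (F i) <= B i) ->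
   `|Re (\sum_(i < n) F i)| <= \sum_(i < n) B i /\
   `|Im (\sum_(i < n) F i)| <= \sum_(i < n) B i.
Proof.
move=> h; split; [rewrite Re_sum|rewrite Im_sum];
  apply: (le_trans (ler_norm_sum _ _ _)); apply: ler_sum => i _;
  apply: le_trans (h i).
- exact: Re_le.
- exact: Im_le.
Qed.

Lemma normc_logterm_le z i : nc (((-1) ^+ i / i.+1%:R)%:C * z ^+ i.+1) <= nc z ^+ i.+1.
Proof.
rewrite Normc.normcM normcX normc_rc ler_piMl ?exprn_ge0 ?normc_ge0//.
rewrite normrM normrX normrN1 expr1n mul1r ger0_norm ?invr_ge0//.
by rewrite invf_le1 ?ler1n// ltr0n.
Qed.

Lemma logpoly_bound z J : nc z < 1 -> `|Re (logpoly z J)| <= (1 - nc z)^-1.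
Proof.
move=> z1; have [h _] := normc_sum_le J _ _ (fun i => normc_logterm_le z i).
apply: (le_trans h); apply: le_trans (geometric_sum_le (nc z) J _); last by rewrite normc_ge0.
apply: ler_sum => i _; rewrite exprS ler_piMl ?exprn_ge0 ?normc_ge0//; exact: ltW.
Qed.

(** * Complex limits and the exponential of the Mercator series *)

Definition ccvg (u : nat -> C) (l : C) :=
  (Re \o u @ \oo --> Re l) /\ (Im \o u @ \oo --> Im l).

Lemma ccvg_cst z : ccvg (fun=> z) z. Proof. by split; exact: cvg_cst. Qed.

Lemma ccvgD u v l m : ccvg u l -> ccvg v m -> ccvg (fun n => u n + v n) (l + m).
Proof.
move=> [u1 u2] [v1 v2]; split; rewrite ?Re_addc ?Im_addc.
  rewrite (_ : _ \o _ = (Re \o u) + (Re \o v)); first exact: cvgD.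
  by apply/funext => x; rewrite /= Re_addc.
rewrite (_ : _ \o _ = (Im \o u) + (Im \o v)); first exact: cvgD.
by apply/funext => x; rewrite /= Im_addc.
Qed.

Lemma ccvgM u v l m : ccvg u l -> ccvg v m -> ccvg (fun n => u n * v n) (l * m).
Proof.
move=> [u1 u2] [v1 v2]; split; rewrite ?Re_mulc ?Im_mulc.
  rewrite (_ : _ \o _ = (Re \o u) * (Re \o v) - (Im \o u) * (Im \o v)).
    by apply: cvgB; exact: cvgM.
  by apply/funext => x; rewrite /= Re_mulc.
rewrite (_ : _ \o _ = (Re \o u) * (Im \o v) + (Im \o u) * (Re \o v)).
  by apply: cvgD; exact: cvgM.
by apply/funext => x; rewrite /= Im_mulc.
Qed.

Lemma ccvgN u l : ccvg u l -> ccvg (fun n => - u n) (- l).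
Proof.
move=> ul; have := ccvgM _ _ _ _ (ccvg_cst (-1)) ul; rewrite mulN1r.
by under eq_fun do rewrite mulN1r.
Qed.

Lemma ccvg_cexp u l : ccvg u l -> ccvg (fun n => cexp (u n)) (cexp l).
Proof.
move=> [u1 u2]; split.
  rewrite (_ : _ \o _ = (expR \o (Re \o u)) * (cos \o (Im \o u)))//.
  apply: cvgM; apply: continuous_cvg => //; [exact: continuous_expR|exact: continuous_cos].
rewrite (_ : _ \o _ = (expR \o (Re \o u)) * (sin \o (Im \o u)))//.
apply: cvgM; apply: continuous_cvg => //; [exact: continuous_expR|exact: continuous_sin].
Qed.

Lemma ccvg_unique u l m : ccvg u l -> ccvg u m -> l = m.
Proof.
move=> [u1 u2] [v1 v2]; apply: complexP.
  by rewrite -(cvg_lim _ u1)// -(cvg_lim _ v1).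
by rewrite -(cvg_lim _ u2)// -(cvg_lim _ v2).
Qed.

Lemma ccvg_series (u : nat -> C) (a q : R) : 0 <= q < 1 -> 0 <= a ->
  (forall i, nc (u i) <= a * q ^+ i) -> exists l, ccvg (fun n => \sum_(i < n) u i) l.
Proof.
move=> /andP[q0 q1] a0 h.
have gc : cvgn (series (geometric a q)).
  by apply: is_cvg_geometric_series; rewrite ger0_norm.
have c1 : cvgn (series (Re \o u)).
  apply: normed_cvg; apply: series_le_cvg gc => n //=.
    by rewrite mulr_ge0// exprn_ge0.
  exact: le_trans (Re_le _) (h n).
have c2 : cvgn (series (Im \o u)).
  apply: normed_cvg; apply: series_le_cvg gc => n //=.
    by rewrite mulr_ge0// exprn_ge0.
  exact: le_trans (Im_le _) (h n).
exists (complex.Complex (limn (series (Re \o u))) (limn (series (Im \o u)))).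
split => /=.
  rewrite (_ : _ \o _ = series (Re \o u))//.
  by apply/funext => n; rewrite /= Re_sum /series/= big_mkord.
rewrite (_ : _ \o _ = series (Im \o u))//.
by apply/funext => n; rewrite /= Im_sum /series/= big_mkord.
Qed.

Lemma is_derive_within_continuous (F f : R -> R) : (forall t : R, is_derive t 1 F (f t)) ->
  {within `[0, 1], continuous F}.
Proof. by move=> h; apply: derivable_within_continuous => t _; by case: (h t). Qed.

(* The function t |-> (1 + t z) cexp (- logpoly (t z)) is 1 at t = 0 and has
   derivative cexp (- logpoly (t z)) z (- t z)^J, which is O(|z|^J) on [0, 1]. *)
Lemma cexp_logpoly z : nc z < 1 ->
  ccvg (fun J => (1 + z) * cexp (- logpoly z J)) 1.
Proof.
move=> z1; set r := nc z.
have r0 : 0 <= r := normc_ge0 z.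
pose K J t := (1 + t%:C * z) * cexp (- logpoly (t%:C * z) J).
pose dK J t := z * (- (t%:C * z)) ^+ J * cexp (- logpoly (t%:C * z) J).
have hK J t : cderive (K J) t (dK J t).
  have h1 := cderiveM _ _ _ _ _ (cderive_rc t) (cderive_cst z t).
  have h2 := cderiveD _ _ _ _ _ (cderive_cst 1 t) h1.
  have h3 := cderiveM _ _ _ _ _ (cderive_cst (-1) t) (cderive_logpoly z J t).
  have h4 := cderive_cexp _ _ _ h3.
  have := cderiveM _ _ _ _ _ h2 h4.
  rewrite (_ : _ + _ = dK J t) /=.
    by move=> h; rewrite /K; under eq_fun do rewrite -mulN1r.
  rewrite /dK !(mulN1r, mul0r, add0r, mulr0, addr0, mul1r) mulrA -mulrDl.
  congr (_ * _).
  (* Multiplying the geometric sum of ratio -t z by 1 + t z leaves only the power of order J, which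
     makes the derivative of [K J] small. *)
  have : (1 - (- (t%:C * z))) * (\sum_(i < J) (- (t%:C * z)) ^+ i) = 1 - (- (t%:C * z)) ^+ J.
    by rewrite -opprB mulNr -subrX1 opprB.
  rewrite opprK -mulr_sumr mulrN => e.
  by rewrite mulrCA e; ring.
have bK J t : t \in `]0, 1[ -> nc (dK J t) <= expR ((1 - r)^-1) * r ^+ J.
  rewrite in_itv/= => /andP[t0 t1].
  have tz : nc (t%:C * z) <= r.
    rewrite Normc.normcM normc_rc gtr0_norm// ler_piMl//; exact: ltW.
  rewrite /dK 2!Normc.normcM normc_cexp mulrC.
  apply: ler_pM; rewrite ?expR_ge0 ?mulr_ge0 ?normc_ge0//.
    rewrite ler_expR (_ : Re (- _) = - Re (logpoly (t%:C * z) J)); last by case: (logpoly _ _).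
    apply: (le_trans (ler_norm _)); rewrite normrN.
    apply: (le_trans (logpoly_bound _ _ _)); first exact: le_lt_trans tz _.
    by rewrite lef_pV2 ?posrE ?subr_gt0 ?(le_lt_trans tz)// lerB.
  rewrite normcX -[X in _ <= X]mul1r; apply: ler_pM; rewrite ?normc_ge0 ?exprn_ge0 ?normc_ge0//.
    exact: ltW.
  apply: lerXn2r; rewrite ?nnegrE ?normc_ge0//.
  by rewrite normcN.
have k0 J : K J 0 = 1.
  rewrite /K rc0 mul0r addr0 mul1r /logpoly big1 ?oppr0 ?cexp0// => i _.
  by rewrite exprS mul0r mulr0.
have k1 J : K J 1 = (1 + z) * cexp (- logpoly z J).
  by rewrite /K rc1 mul1r.
have B0 : (fun J => expR ((1 - r)^-1) * r ^+ J) @ \oo --> 0.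
  rewrite -[0](mulr0 (expR (1 - r)^-1)); apply: cvgMr.
  by apply: cvg_expr; rewrite ger0_norm.
(* The mean value theorem fails for complex values, so it is applied to the two components, each
   with its own point [c]. *)
split; apply/cvgrPdistC_le => e ee.
  near=> J.
  have [c c01] := MVT ltr01 (fun t _ => (hK J t).1) (is_derive_within_continuous _ _ (fun t => (hK J t).1)).
  rewrite subr0 mulr1 /= k1 k0 => ->.
  apply: (le_trans (Re_le _)); apply: (le_trans (bK _ _ c01)).
  by near: J; exact: (cvgr_le 0 B0).
near=> J.
have [c c01] := MVT ltr01 (fun t _ => (hK J t).2) (is_derive_within_continuous _ _ (fun t => (hK J t).2)).
rewrite subr0 mulr1 /= k1 k0 => ->.
apply: (le_trans (Im_le _)); apply: (le_trans (bK _ _ c01)).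
by near: J; exact: (cvgr_le 0 B0).
Unshelve. all: by end_near. Qed.

(** By uniqueness of limits (1 + z) cexp (-l) = 1 for the sum l of the Mercator series; multiplying
    by cexp l gives the claim. *)
Lemma cexp_log z : nc z < 1 ->
  exists2 l, ccvg (logpoly z) l & cexp l = 1 + z.
Proof.
move=> z1.
have [||i|l hl] := ccvg_series (fun i => ((-1) ^+ i / i.+1%:R)%:C * z ^+ i.+1) 1 (nc z).
- by rewrite normc_ge0.
- by [].
- apply: (le_trans (normc_logterm_le z i)).
  by rewrite mul1r exprS ler_piMl ?exprn_ge0 ?normc_ge0//; exact: ltW.
exists l => //.
have h := ccvgM _ _ _ _ (ccvg_cst (1 + z)) (ccvg_cexp _ _ (ccvgN _ _ hl)).
have e := ccvg_unique _ _ _ h (cexp_logpoly z z1).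
transitivity ((1 + z) * cexp (- l) * cexp l); first by rewrite e mul1r.
by rewrite -mulrA -cexpD addNr cexp0 mulr1.
Qed.

End Complex.

(** * Truncated zeta sums, the coefficient series and the infinite product *)

Section ZetaSeries.
Variable R : realType.
Local Notation C := (complex.complex R).
Local Notation Re := (@complex.Re R).
Local Notation Im := (@complex.Im R).
Local Notation "x %:C" := (complex.real_complex_def (Phant R) x) (at level 2, format "x %:C").
Local Notation nc := (@complex.ComplexField.Normc.normc R).

(* Starts at n = 2, so that [coef_partial] approximates the factor zeta(j) - 1. *)
Definition zeta_partial (N j : nat) : R := \sum_(2 <= n < N) (n%:R ^+ j)^-1.

(** For n >= N, n^-j <= N^(2-j) n^-2, and n^-2 <= 1/(n-1) - 1/n telescopes to at most 1/(N-1). The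
    bound is geometric in [j], and its factor 1/(N-1) still tends to 0 after summation over [j]. *)
Lemma zeta_partial_tail (N M j : nat) : (2 <= N)%N -> (2 <= j)%N ->
  0 <= \sum_(N <= n < M) ((n%:R : R) ^+ j)^-1 <= N%:R ^+ 2 / N%:R ^+ j / (N%:R - 1).
Proof.
move=> N2 j2; have N1 : 1 < N%:R :> R by rewrite ltr1n.
have N0 : 0 < N%:R :> R by lra.
have N10 : 0 < N%:R - 1 :> R by lra.
apply/andP; split; first by apply: sumr_ge0 => n _; rewrite invr_ge0 exprn_ge0.
have [MN|NM] := leqP M N.
  rewrite big_geq//; apply: divr_ge0; last exact: ltW.
  by rewrite divr_ge0 ?exprn_ge0// ltW.
apply: (@le_trans _ _ (N%:R ^+ 2 / N%:R ^+ j * \sum_(N <= n < M) ((n%:R - 1)^-1 - (n.+1%:R - 1)^-1))).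
  rewrite mulr_sumr big_nat_cond [X in _ <= X]big_nat_cond; apply: ler_sum => n /andP[/andP[Nn nM] _].
  have Nn' : N%:R <= n%:R :> R by rewrite ler_nat.
  have n0 : 0 < n%:R :> R by lra.
  have -> : (n%:R : R) ^+ j = n%:R ^+ 2 * n%:R ^+ (j - 2) by rewrite -exprD subnKC.
  have -> : (N%:R : R) ^+ j = N%:R ^+ 2 * N%:R ^+ (j - 2) by rewrite -exprD subnKC.
  have -> : (N%:R : R) ^+ 2 / (N%:R ^+ 2 * N%:R ^+ (j - 2)) = (N%:R ^+ (j - 2))^-1.
    by field; rewrite !expf_neq0 ?gt_eqF.
  rewrite invfM mulrC; apply: ler_pM; rewrite ?invr_ge0 ?exprn_ge0 ?(ltW n0) ?(ltW N0)//.
    rewrite lef_pV2; [|by rewrite posrE exprn_gt0|by rewrite posrE exprn_gt0].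
    by apply: lerXn2r => //; rewrite nnegrE ler0n.
  rewrite -natr1 addrK.
  have n1 : 0 < n%:R - 1 :> R by lra.
  rewrite (_ : _ - _ = ((n%:R - 1) * n%:R)^-1); last by field; rewrite !gt_eqF.
  by rewrite lef_pV2 ?posrE ?exprn_gt0 ?mulr_gt0// expr2 ler_pM2r// gerBl.
apply: ler_wpM2l; first by rewrite divr_ge0 ?exprn_ge0 ?(ltW N0).
have := @telescope_sumr _ N M (fun n => - (n%:R - 1)^-1 : R) (ltnW NM).
under eq_bigr do rewrite opprK addrC.
move=> ->; rewrite opprK addrC gerBl invr_ge0.
have : 1 <= M%:R :> R by rewrite ler1n; case: (M) NM.
by lra.
Qed.

Lemma zeta_sub_partial (N j : nat) : (2 <= N)%N -> (2 <= j)%N ->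
  0 <= zeta_nat R j - 1 - zeta_partial N j <= N%:R ^+ 2 / N%:R ^+ j / (N%:R - 1).
Proof.
move=> N2 j2.
pose u M : R := \sum_(1 <= n < M) (n%:R ^+ j)^-1.
have split_u M : (N <= M)%N -> u M = 1 + zeta_partial N j + \sum_(N <= n < M) (n%:R ^+ j)^-1.
  move=> NM; rewrite /u (@big_cat_nat _ _ _ 2%N)//=; last by lia.
  by rewrite (@big_cat_nat _ _ _ N _ M)//= big_nat1 expr1n invr1 addrA.
(* [zeta_nat] is a [limn], so it carries information only once convergence is known; here the
   sequence is monotone and bounded. *)
have cu : cvgn u.
  apply: nondecreasing_is_cvgn.
    apply/nondecreasing_seqP => n; case: n => [|n].
      by rewrite /u !big_geq.
    by rewrite /u [X in _ <= X]big_nat_recr//= lerDl invr_ge0 exprn_ge0.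
  exists (1 + zeta_partial N j + N%:R ^+ 2 / N%:R ^+ j / (N%:R - 1)) => _ [M _ <-].
  apply: (@le_trans _ _ (u (maxn M N))).
    have [MN|NM] := leqP M N; last by rewrite lexx.
    rewrite /u; have [M1|M1] := leqP M 1.
      by rewrite big_geq//; apply: sumr_ge0 => n _; rewrite invr_ge0 exprn_ge0.
    rewrite (@big_cat_nat _ _ _ M _ N)//=; last by lia.
    by rewrite lerDl; apply: sumr_ge0 => n _; rewrite invr_ge0 exprn_ge0.
  rewrite split_u ?leq_maxr// lerD2l.
  by have /andP[] := zeta_partial_tail N (maxn M N) j N2 j2.
rewrite -/(limn u) -addrA -opprD.
have ge M : (N <= M)%N -> 0 <= u M - (1 + zeta_partial N j) <= N%:R ^+ 2 / N%:R ^+ j / (N%:R - 1).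
  by move=> NM; rewrite split_u// [_ + _ - _]addrAC subrr add0r; exact: zeta_partial_tail.
rewrite subr_ge0 lerBlDl; apply/andP; split.
  apply: limr_ge => //; near=> M.
  have /ge : (N <= M)%N by near: M; exact: nbhs_infty_ge.
  by rewrite subr_ge0 => /andP[].
apply: limr_le => //; near=> M.
have /ge : (N <= M)%N by near: M; exact: nbhs_infty_ge.
by rewrite lerBlDl => /andP[].
Unshelve. all: by end_near. Qed.

Definition coef_partial (N j : nat) : R :=
  (-1) ^+ j / j%:R * (1 - (2 ^+ j.-1)^-1) * zeta_partial N j.

Lemma coef_bound (N j : nat) : (2 <= N)%N -> (2 <= j)%N ->
  `|coef R j - coef_partial N j| <= N%:R ^+ 2 / N%:R ^+ j / (N%:R - 1).
Proof.
move=> N2 j2; have /andP[z0 zb] := zeta_sub_partial N j N2 j2.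
rewrite /coef /coef_partial -mulrBr normrM (ger0_norm z0); apply: le_trans zb.
rewrite ler_piMl// !normrM normrX normrN1 expr1n mul1r.
have j0 : 1 <= j%:R :> R by rewrite ler1n (leq_trans _ j2).
have p0 : 1 <= 2 ^+ j.-1 :> R by rewrite exprn_ege1// ler1n.
have p1 : (2 ^+ j.-1)^-1 <= 1 :> R by rewrite invf_le1//; lra.
have p2 : 0 <= (2 ^+ j.-1)^-1 :> R by rewrite invr_ge0; lra.
rewrite ger0_norm ?invr_ge0 ?ler0n//.
rewrite ger0_norm; last by lra.
rewrite -[X in _ <= X]mulr1; apply: ler_pM; rewrite ?invr_ge0//; try lra.
by rewrite invf_le1//; lra.
Qed.

Lemma zeta_partial2 j : zeta_partial 2 j = 0. Proof. by rewrite /zeta_partial big_geq. Qed.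

(** Case N = 2 of [coef_bound], where the partial zeta sum is empty. The rate 2^-j is the source of
    the condition |s| < 2. *)
Lemma coef_bound2 j : (2 <= j)%N -> `|coef R j| <= 4 / 2 ^+ j.
Proof.
move=> j2; have := coef_bound 2 j (leqnn _) j2.
rewrite /coef_partial zeta_partial2 mulr0 subr0 => /le_trans; apply.
by rewrite (_ : 2 - 1 = 1 :> R) ?divr1 ?expr2 -?natrM//; lra.
Qed.

(** In 2 log(1 + s/(2n)) - log(1 + s/n) the coefficient of (s/n)^j is (-1)^(j-1)/j (2 2^-j - 1) =
    (-1)^j/j (1 - 2^(1-j)). At finite [N] and [J] the two sums can be exchanged freely. *)
Lemma logpoly_product (s : C) (N J : nat) :
  \sum_(2 <= n < N) (2 * logpoly R ((n%:R^-1)%:C * (2^-1%:C * s)) J - logpoly R ((n%:R^-1)%:C * s) J)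
  = \sum_(2 <= j < J.+1) (coef_partial N j)%:C * s ^+ j.
Proof.
transitivity (\sum_(i < J) (coef_partial N i.+1)%:C * s ^+ i.+1).
  under eq_bigr do rewrite /logpoly mulr_sumr -sumrB.
  rewrite exchange_big/=; apply: eq_bigr => i _.
  rewrite /coef_partial /zeta_partial mulr_sumr.
  have -> : (\sum_(2 <= n < N) (-1) ^+ i.+1 / i.+1%:R * (1 - (2 ^+ i.+1.-1)^-1) * (n%:R ^+ i.+1)^-1)%:C
   = \sum_(2 <= n < N) ((-1) ^+ i.+1 / i.+1%:R * (1 - (2 ^+ i.+1.-1)^-1) * ((n%:R : R) ^+ i.+1)^-1)%:C.
    by apply: (big_morph (fun x : R => x%:C)); [exact: rcD|].
  rewrite mulr_suml; apply: eq_bigr => n _.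
  rewrite !exprMn -!rcX !exprVn.
  set c := (-1) ^+ i / i.+1%:R : R; set v := (n%:R ^+ i.+1)^-1 : R.
  rewrite (_ : (-1) ^+ i.+1 / i.+1%:R * (1 - (2 ^+ i.+1.-1)^-1) * v =
    2 * (c * v * (2 ^+ i.+1)^-1) + (-1) * (c * v)); last first.
    rewrite /c [i.+1.-1]/= !exprS; field.
    by rewrite nat1r pnatr_eq0 expf_neq0.
  rewrite rcD !rcM rcN1 (_ : 2%:C = 2); last by rewrite -[2%:C]/(1 + 1)%:C rcD rc1.
  by ring.
rewrite -(big_mkord xpredT (fun i => (coef_partial N i.+1)%:C * s ^+ i.+1)).
case: J => [|J]; first by rewrite !big_geq.
(* The term of degree 1 drops out because 1 - 2^0 = 0; hence the series starts at j = 2. *)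
rewrite big_nat_recl//= /coef_partial/= expr0 invr1 subrr mulr0 mul0r rc0 mul0r add0r.
by rewrite -(big_add1 _ _ 0 J.+1 xpredT (fun i => (coef_partial N i.+1)%:C * s ^+ i.+1)) -(big_add1 _ _ 1 J.+2 xpredT (fun i => (coef_partial N i)%:C * s ^+ i)).
Qed.

Lemma normc_rcM (x : R) (z : C) : nc (x%:C * z) = `|x| * nc z.
Proof. by rewrite Normc.normcM normc_rc. Qed.

(** Gives meaning to the [limn] in [S_re] and [S_im]: by [coef_bound2] the terms are dominated by a
    geometric series of ratio |s|/2. *)
Lemma ccvg_coef_series (s : C) : nc s < 2 ->
  ccvg R (fun J => \sum_(2 <= j < J) (coef R j)%:C * s ^+ j)
    (complex.Complex (S_re s) (S_im s)).
Proof.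
move=> s2; pose u i := if (i < 2)%N then 0 else (coef R i)%:C * s ^+ i.
have sE J : \sum_(2 <= j < J) (coef R j)%:C * s ^+ j = \sum_(i < J) u i.
  have [J2|J2] := leqP J 2.
    rewrite big_geq// big1// => i _; rewrite /u.
    by rewrite (leq_trans (ltn_ord i) J2).
  rewrite -(big_mkord xpredT u) [RHS](@big_cat_nat _ _ _ 2%N)//=; last exact: ltnW.
  rewrite [X in _ = X + _]big_nat_cond [X in _ = X + _]big1 ?add0r; last first.
    by move=> i /andP[/andP[_ i2] _]; rewrite /u i2.
  rewrite big_nat_cond [RHS]big_nat_cond; apply: eq_bigr => i /andP[/andP[i2 _] _].
  by rewrite /u ltnNge i2.
have r0 := normc_ge0 R s.
have [|//|i|l [l1 l2]] := ccvg_series R u 4 (nc s / 2).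
- by rewrite divr_ge0//= ltr_pdivrMr// mul1r.
- rewrite /u; case: ltnP => [_|i2].
    by rewrite Normc.normc0 mulr_ge0// exprn_ge0// divr_ge0.
  rewrite normc_rcM normcX expr_div_n mulrA mulrAC.
  by apply: ler_wpM2r; [exact: exprn_ge0|exact: coef_bound2].
suff -> : complex.Complex (S_re s) (S_im s) = l.
  by under eq_fun do rewrite sE.
apply: complexP => /=.
  rewrite /S_re; apply: cvg_lim => //.
  by rewrite (_ : (fun _ => _) = Re \o (fun n => \sum_(i < n) u i))//; apply/funext => J; rewrite /= -sE Re_sum.
rewrite /S_im; apply: cvg_lim => //.
by rewrite (_ : (fun _ => _) = Im \o (fun n => \sum_(i < n) u i))//; apply/funext => J; rewrite /= -sE Im_sum.
Qed.

(** The bound does not depend on [J], so [J] can tend to infinity at fixed [N], and [N] afterwards.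
    It sums [coef_bound] over the degrees; the ratio |s|/N is weakened to |s|/2, a ratio below 1
    that is the same for all [N]. *)
Lemma truncation_bound (s : C) (N J : nat) : nc s < 2 -> (2 <= N)%N ->
  let d := \sum_(2 <= j < J) (coef R j)%:C * s ^+ j
         - \sum_(2 <= j < J) (coef_partial N j)%:C * s ^+ j in
  let B := nc s ^+ 2 / (1 - nc s / 2) / (N%:R - 1) in
  `|Re d| <= B /\ `|Im d| <= B.
Proof.
move=> s2 N2 d B; set r := nc s.
have r0 : 0 <= r by exact: normc_ge0.
have N2' : 2 <= N%:R :> R by rewrite ler_nat.
have N0 : 0 < N%:R :> R by lra.
have -> : d = \sum_(i < J - 2) ((coef R i.+2 - coef_partial N i.+2)%:C * s ^+ i.+2).
  rewrite /d -sumrB -{1}[2%N]add0n big_addn big_mkord; apply: eq_bigr => i _.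
  by rewrite addn2 -mulrBl; congr (_ * _); apply: complexP; rewrite /= ?subr0.
have tb (i : 'I_(J - 2)) : nc ((coef R i.+2 - coef_partial N i.+2)%:C * s ^+ i.+2) <=
   r ^+ 2 / (N%:R - 1) * (r / 2) ^+ i.
  rewrite normc_rcM normcX -/r.
  apply: (@le_trans _ _ (N%:R ^+ 2 / N%:R ^+ i.+2 / (N%:R - 1) * r ^+ i.+2)).
    by apply: ler_wpM2r; [exact: exprn_ge0|exact: coef_bound].
  rewrite (_ : _ * r ^+ i.+2 = r ^+ 2 / (N%:R - 1) * (r / N%:R) ^+ i); last first.
    rewrite expr_div_n -[i.+2]addn2 !exprD; field.
    by rewrite expf_neq0 ?gt_eqF//; lra.
  apply: ler_wpM2l.
    by rewrite divr_ge0 ?exprn_ge0//; lra.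
  apply: lerXn2r; rewrite ?nnegrE ?divr_ge0 ?(ltW N0)//.
  by apply: ler_wpM2l => //; rewrite lef_pV2 ?posrE.
have [h1 h2] := normc_sum_le R _ _ _ tb.
have hB : \sum_(i < J - 2) r ^+ 2 / (N%:R - 1) * (r / 2) ^+ i <= B.
  rewrite -mulr_sumr /B -/r [X in _ <= X]mulrAC; apply: ler_wpM2l.
    by rewrite divr_ge0 ?exprn_ge0//; lra.
  by apply: geometric_sum_le; rewrite divr_ge0//= ltr_pdivrMr// mul1r.
by split; [apply: le_trans h1 hB|apply: le_trans h2 hB].
Qed.

(** The shift in [v] matches [logpoly_product], where [J] Mercator terms correspond to the degrees
    below J + 1. *)
Lemma cvg_dist_le (u v : nat -> R) (a b B : R) : u @ \oo --> a -> v @ \oo --> b ->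
  (forall n, `|u n - v n.+1| <= B) -> `|a - b| <= B.
Proof.
move=> ua vb h; have vb' : (fun n => v n.+1) @ \oo --> b by rewrite cvg_shiftS.
have d : `|u n - v n.+1| @[n --> \oo] --> `|a - b| by apply: cvg_norm; exact: cvgB.
rewrite -(cvg_lim _ d)//; apply: limr_le; first by apply/cvg_ex; eexists; exact: d.
by apply: nearW.
Qed.

(** Iterating the relation up to [N] gives I 2 = cexp (T N) I N, where T N is a sum of logarithm
    series. Working with T N instead of the finite product lets the limit be taken in the
    exponent. *)
Lemma infinite_product (s : C) (I : nat -> C) : nc s < 2 ->
  (forall n, (2 <= n)%N ->
    (1 + (n%:R^-1)%:C * s) * I n = (1 + (n%:R^-1)%:C * (2^-1%:C * s)) ^+ 2 * I n.+1) ->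
  ccvg R I 1 ->
  I 2%N = cexp R (complex.Complex (S_re s) (S_im s)).
Proof.
move=> s2 hI I1; set S := complex.Complex _ _.
have r0 := normc_ge0 R s.
pose L N J := \sum_(2 <= n < N)
  (2 * logpoly R ((n%:R^-1)%:C * (2^-1%:C * s)) J - logpoly R ((n%:R^-1)%:C * s) J).
have hT N : exists T, (2 <= N)%N -> ccvg R (L N) T /\ I 2%N = cexp R T * I N.
  elim: N => [|N [T IH]]; first by exists 0.
  have [N1|N2] := leqP N 1.
    exists 0 => N2; have -> : N = 1%N by lia.
    split; last by rewrite cexp0 mul1r.
    rewrite /L; under eq_fun do rewrite big_geq//.
    exact: ccvg_cst.
  have [cT eT] := IH N2.
  have N2' : 2 <= N%:R :> R by rewrite ler_nat.
  have z1 : nc ((N%:R^-1)%:C * s) < 1.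
    rewrite normc_rcM ger0_norm ?invr_ge0// mulrC ltr_pdivrMr; lra.
  have z2 : nc ((N%:R^-1)%:C * (2^-1%:C * s)) < 1.
    rewrite !normc_rcM ger0_norm ?invr_ge0// ger0_norm ?invr_ge0// mulrC ltr_pdivrMr; lra.
  have [l1 cl1 el1] := cexp_log R _ z1.
  have [l2 cl2 el2] := cexp_log R _ z2.
  exists (T + (2 * l2 - l1)) => _; split.
    rewrite /L; under eq_fun do rewrite big_nat_recr//.
    apply: ccvgD; first exact: cT.
    apply: ccvgD; last exact: ccvgN.
    by apply: ccvgM => //; exact: ccvg_cst.
  rewrite cexpD -mulrA eT; congr (_ * _).
  have := hI N N2; rewrite -el1 -el2 => e.
  (* The factor 1 + s/N is divided out by multiplying with cexp (-l1), the exponential form making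
     its inverse explicit. *)
  have : cexp R (- l1) * (cexp R l1 * I N) = cexp R (- l1) * (cexp R l2 ^+ 2 * I N.+1).
    by rewrite e.
  rewrite mulrA -cexpD addNr cexp0 mul1r => ->.
  rewrite mulrA expr2 -!cexpD; congr (cexp _ _ * _); ring.
have [T hTN] := choice hT.
have TS : ccvg R T S.
  pose c := nc s ^+ 2 / (1 - nc s / 2).
  have B0 : (fun N : nat => c / (N%:R - 1)) @ \oo --> (0 : R).
    rewrite -[0](mulr0 c); apply: cvgMr.
    apply/gtr0_cvgV0.
      near=> n; rewrite subr_gt0 ltr1n; near: n; exact: nbhs_infty_gt.
    rewrite (_ : (fun _ => _) = (fun n : nat => n%:R + (- 1) : R))//.
    apply/cvgryPge => A; near=> n.
    rewrite lerBrDr; near: n; exact: nbhs_infty_ger.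
  have key N : (2 <= N)%N -> `|Re (T N) - Re S| <= c / (N%:R - 1) /\ `|Im (T N) - Im S| <= c / (N%:R - 1).
    move=> N2; have [[t1 t2] _] := hTN N N2.
    have [u1 u2] := ccvg_coef_series s s2.
    have bd J := truncation_bound s N J.+1 s2 N2.
    have hN (x y : C) : Re (x - y) = Re x - Re y /\ Im (x - y) = Im x - Im y.
      by case: x; case: y.
    split; [apply: (cvg_dist_le _ _ _ _ _ t1 u1)|apply: (cvg_dist_le _ _ _ _ _ t2 u2)] => J /=.
      by rewrite /L logpoly_product distrC -(hN _ _).1; exact: (bd J).1.
    by rewrite /L logpoly_product distrC -(hN _ _).2; exact: (bd J).2.
  split; apply/cvgrPdistC_le => e e0; near=> N.
    have [|k _] := key N; first by near: N; exact: nbhs_infty_ge.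
    by apply: le_trans k _; near: N; exact: (cvgr_le 0 B0).
  have [|_ k] := key N; first by near: N; exact: nbhs_infty_ge.
  by apply: le_trans k _; near: N; exact: (cvgr_le 0 B0).
have h := ccvgM R _ _ _ _ (ccvg_cexp R _ _ TS) I1; rewrite mulr1 in h.
apply: (ccvg_unique R (fun N => cexp R (T N) * I N)) => //.
case: (ccvg_cst R (I 2%N)) => h1 h2; split.
  apply: cvg_trans h1; apply: near_eq_cvg; near=> N => /=.
  have [|_ <-//] := hTN N; near: N; exact: nbhs_infty_ge.
apply: cvg_trans h2; apply: near_eq_cvg; near=> N => /=.
have [|_ <-//] := hTN N; near: N; exact: nbhs_infty_ge.
Unshelve. all: by end_near. Qed.
End ZetaSeries.

(** * Integrals of exact derivatives along slices of the disk *)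

Section Slice.
Context {R : realType}.
Notation mu := (@lebesgue_measure R).
Variables (phi psi : R -> R).
Hypothesis hphi : forall x : R, is_derive x 1 phi (psi x).
Hypothesis cpsi : continuous psi.

(* Derivative of t |-> (c - t^2)^(k+1) phi(log |1+x|) (t + m) along a slice of
   the disk on which |1+x|^2 = (t + e)^2 + d. *)
Definition slice_deriv (k : nat) (c e d m t : R) : R :=
  let q := (t + e) ^+ 2 + d in let l := ln (Num.sqrt q) in
  k.+1%:R * (c - t ^+ 2) ^+ k * (- 2 * t) * phi l * (t + m) +
  (c - t ^+ 2) ^+ k.+1 * (psi l * ((t + e) / q)) * (t + m) +
  (c - t ^+ 2) ^+ k.+1 * phi l.

Lemma is_derive_lnsqrt (e d t : R) : 0 < (t + e) ^+ 2 + d ->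
  is_derive t 1 (fun t => ln (Num.sqrt ((t + e) ^+ 2 + d))) ((t + e) / ((t + e) ^+ 2 + d)).
Proof.
move=> q0; set q := (t + e) ^+ 2 + d.
have h1 : is_derive t 1 (fun t : R => (t + e) ^+ 2 + d) (2 * (t + e)).
  by apply: is_derive_eq; rewrite /GRing.scale/=; ring.
have h2 : is_derive q 1 (@Num.sqrt R) (2 * Num.sqrt q)^-1 by exact: is_derive1_sqrt.
have sq0 : 0 < Num.sqrt q by rewrite sqrtr_gt0.
have h12 := @is_derive1_comp R (@Num.sqrt R) (fun t : R => (t + e) ^+ 2 + d) t _ _ h2 h1.
have h3 := @is_derive1_comp R (@ln R) (@Num.sqrt R \o (fun t : R => (t + e) ^+ 2 + d)) t _ _
  (is_derive1_ln sq0) h12.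
rewrite (_ : (t + e) / q = (Num.sqrt q)^-1 * ((2 * Num.sqrt q)^-1 * (2 * (t + e)))) //.
rewrite -[X in _ / X](sqr_sqrtr (ltW q0)).
by field; rewrite gt_eqF.
Qed.

Lemma is_derive_continuous (f : R -> R) (x d : R) : is_derive x 1 f d -> {for x, continuous f}.
Proof. by move=> h; apply/differentiable_continuous/derivable1_diffP; by case: h. Qed.

(** The antiderivative [F] is killed at both ends by (r^2 - t^2)^(k+1). Positivity of (t + e)^2 + d
    on the closed slice keeps it away from x = -1, so the logarithm is smooth along it. *)
Lemma slice_integral0 (k : nat) (r e d m : R) : 0 < r ->
  (forall t, -r <= t <= r -> 0 < (t + e) ^+ 2 + d) ->
  (\int[mu]_(t in `[(- r)%R, r]) (slice_deriv k (r ^+ 2) e d m t)%:E = 0)%E.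
Proof.
move=> r0 qpos.
pose F t := (r ^+ 2 - t ^+ 2) ^+ k.+1 * phi (ln (Num.sqrt ((t + e) ^+ 2 + d))) * (t + m).
have dF (t : R) : t \in `[-r, r] -> is_derive t 1 F (slice_deriv k (r ^+ 2) e d m t).
  rewrite in_itv/= => /qpos q0.
  have h1 := is_derive_lnsqrt _ _ _ q0.
  have h2 := @is_derive1_comp R phi (fun t => ln (Num.sqrt ((t + e) ^+ 2 + d))) t _ _ (hphi _) h1.
  have h3 : is_derive t 1 (fun t : R => (r ^+ 2 - t ^+ 2)) (- 2 * t).
    by apply: is_derive_eq; rewrite /GRing.scale/=; ring.
  have h4 := is_deriveX k.+1 h3.
  have h5 : is_derive t 1 (fun t : R => t + m) 1.
    by apply: is_derive_eq; rewrite addr0.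
  have h6 := is_deriveM (is_deriveM h4 h2) h5.
  rewrite (_ : F = ((fun t : R => r ^+ 2 - t ^+ 2) ^+ k.+1 *
    (phi \o (fun t => ln (Num.sqrt ((t + e) ^+ 2 + d))))) * (fun t : R => t + m)); last first.
    by apply/funext => u; rewrite /F !fctE.
  apply: (is_derive_eq h6).
  by rewrite /slice_deriv /GRing.scale/= !fctE; ring.
have cdF (t : R) : t \in `[-r, r] -> {for t, continuous (slice_deriv k (r ^+ 2) e d m)}.
  rewrite in_itv/= => /qpos q0.
  have cl := is_derive_continuous _ _ _ (is_derive_lnsqrt _ _ _ q0).
  have cp : {for t, continuous (fun t => phi (ln (Num.sqrt ((t + e) ^+ 2 + d))))}.
    by apply: continuous_comp; [exact: cl|exact: is_derive_continuous (hphi _)].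
  have cs : {for t, continuous (fun t => psi (ln (Num.sqrt ((t + e) ^+ 2 + d))))}.
    by apply: continuous_comp; [exact: cl|exact: cpsi].
  have cid : {for t, continuous (fun t : R => t)} by exact: cvg_id.
  have cadd a : {for t, continuous (fun t : R => t + a)} by apply: cvgD; [exact: cid|exact: cvg_cst].
  have cX (f : R -> R) n : {for t, continuous f} -> {for t, continuous (fun t => f t ^+ n)}.
    by move=> cf; apply: (@continuous_comp _ _ _ f (fun x : R => x ^+ n)); [exact: cf|exact: exprn_continuous].
  have cw n : {for t, continuous (fun t : R => (r ^+ 2 - t ^+ 2) ^+ n)}.
    by apply: (cX (fun t => r ^+ 2 - t ^+ 2)); apply: cvgB; [exact: cvg_cst|exact: (cX id 2%N cid)].
  have cq : {for t, continuous (fun t : R => ((t + e) ^+ 2 + d)^-1)}.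
    apply: (@continuousV _ _ (fun t : R => (t + e) ^+ 2 + d)); first by rewrite gt_eqF.
    by apply: cvgD; [exact: (cX (fun t => t + e) 2%N (cadd e))|exact: cvg_cst].
  rewrite /slice_deriv; apply: cvgD; last by apply: cvgM; [exact: cw|exact: cp].
  apply: cvgD.
    apply: cvgM; last exact: cadd.
    apply: cvgM; last exact: cp.
    apply: cvgM; last by apply: cvgM; [exact: cvg_cst|exact: cid].
    by apply: cvgM; [exact: cvg_cst|exact: cw].
  apply: cvgM; last exact: cadd.
  apply: cvgM; first exact: cw.
  apply: cvgM; first exact: cs.
  by apply: cvgM; [exact: cadd|exact: cq].
have rr : - r < r by lra.
have inoo t : t \in `]-r, r[ -> t \in `[-r, r].
  by rewrite !in_itv/= => /andP[/ltW -> /ltW ->].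
have cF : {within `[-r, r], continuous F}.
  by apply: derivable_within_continuous => t /dF [].
rewrite (@continuous_FTC2 _ _ F)//.
- by rewrite /F sqrrN subrr expr0n/= !mul0r subee.
- by apply: continuous_in_subspaceT => t; rewrite inE => /cdF.
- move/(continuous_within_itvP _ rr) : cF => [_ c1 c2].
  by split => // t /inoo/dF [].
- by move=> t /inoo /dF [? <-]; rewrite derive1E.
Qed.
End Slice.

(** * Integrable power singularities on an interval *)

Section ImproperPower.
Context {R : realType}.
Notation mu := (@lebesgue_measure R).
Local Notation A := (@areaR R).
Local Notation D := (@diskR R).

(** The integrand may blow up at an endpoint: the fundamental theorem is used on
    [a + 1/(n+1), b - 1/(n+1)], where the increment of [F] is at most [K], and monotone convergence
    passes to the open interval. *)
Lemma ge0_FTC2_oo_le (f F : R -> R) (a b K : R) :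
  (forall x, a < x < b -> is_derive x 1 F (f x)) ->
  (forall x, a < x < b -> {for x, continuous f}) ->
  (forall x, a < x < b -> 0 <= f x) ->
  (forall x, a < x < b -> 0 <= F x <= K) -> 0 <= K ->
  (\int[mu]_(x in `]a, b[) (f x)%:E <= K%:E)%E.
Proof.
move=> dF cf f0 FK K0.
have [dl [dl0 dlS dlx]] : exists dl : nat -> R, [/\ forall n, 0 < dl n,
    forall n, dl n.+1 <= dl n & forall x, 0 < x -> exists n, dl n < x].
  exists (fun n => n.+1%:R^-1); split => [n|n|x /ltr_add_invr].
  - by rewrite invr_gt0.
  - by rewrite lef_pV2 ?posrE// ler_nat.
  - by move=> [n]; rewrite add0r; exists n.
pose I n : set R := [set` `[a + dl n, b - dl n]].
have inI n x : I n x -> a < x < b.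
  rewrite /I/= in_itv/= => /andP[h1 h2].
  have n0 := dl0 n.
  by apply/andP; split; lra.
have UI : \bigcup_n I n = `]a, b[%classic.
  apply/seteqP; split => x.
    by move=> [n _ /inI]; rewrite /= in_itv.
  rewrite /= in_itv/= => /andP[ax xb].
  have : 0 < Num.min (x - a) (b - x) by rewrite lt_min !subr_gt0 ax xb.
  move=> /dlx[n]; rewrite lt_min => /andP[h1 h2].
  by exists n => //; rewrite /I/= in_itv/=; apply/andP; split; lra.
have mf n : measurable_fun (I n) (fun x => (f x)%:E).
  apply/measurable_EFinP; apply: subspace_continuous_measurable_fun; first exact: measurable_itv.
  by apply: continuous_in_subspaceT => x; rewrite inE => /inI; exact: cf.
have ndI : nondecreasing_seq I.
  apply/nondecreasing_seqP => n; rewrite subsetEset => x; rewrite /I/= !in_itv/=.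
  have := dlS n.
  by move=> h /andP[h1 h2]; apply/andP; split; lra.
have f0' n x : I n x -> (0 <= (f x)%:E)%E by move=> /inI/f0; rewrite lee_fin.
have : (\int[mu]_(x in I n) (f x)%:E @[n --> \oo] --> \int[mu]_(x in \bigcup_n I n) (f x)%:E)%E.
  apply: ge0_nondecreasing_set_cvg_integral => // n; exact: measurable_itv.
rewrite UI => cv; rewrite -(cvg_lim _ cv)//.
apply: lime_le; first by apply/cvg_ex; eexists; exact: cv.
apply: nearW => n.
have [ab|ba] := ltP (a + dl n) (b - dl n); last first.
  move: ba; rewrite le_eqVlt => /orP[/eqP e|ba].
    by rewrite /I e set_itv1 integral_set1 lee_fin.
  by rewrite /I set_itv_ge ?integral_set0 ?lee_fin// -leNgt bnd_simp.
have n0 := dl0 n.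
have cF : {within [set` `[a + dl n, b - dl n]], continuous F}.
  by apply: derivable_within_continuous => t /inI/dF [].
have inoo x : x \in `]a + dl n, b - dl n[ -> a < x < b.
  by rewrite in_itv/= => /andP[h1 h2]; apply/andP; split; lra.
rewrite (@continuous_FTC2 _ _ F)//.
- rewrite -EFinB lee_fin.
  have /FK/andP[_ h1] : a < b - dl n < b by apply/andP; split; lra.
  have /FK/andP[h2 _] : a < a + dl n < b by apply/andP; split; lra.
  lra.
- by apply: continuous_in_subspaceT => x; rewrite inE => /inI; exact: cf.
- move/(continuous_within_itvP _ ab) : cF => [_ c1 c2].
  by split => // t /inoo/dF [].
- by move=> t /inoo /dF [? <-]; rewrite derive1E.
Qed.

Lemma powR_le_neg (x y be : R) : 0 < x -> x <= y -> be <= 0 -> y `^ be <= x `^ be.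
Proof.
move=> x0 xy be0; rewrite /powR !gt_eqF ?(lt_le_trans x0)//.
rewrite ler_expR; apply: ler_wnM2l => //; rewrite ler_ln// posrE.
exact: lt_le_trans xy.
Qed.

Lemma is_derive_powR_affine (be c t x : R) : 0 < c * x + t -> be + 1 != 0 -> c != 0 ->
  is_derive x 1 (fun x => (c * x + t) `^ (be + 1) / (c * (be + 1))) ((c * x + t) `^ be).
Proof.
move=> x0 be0 c0.
have h1 : is_derive x 1 (fun x : R => c * x + t) c.
  by apply: is_derive_eq; rewrite /GRing.scale/=; ring.
have h2 : is_derive (c * x + t) 1 (fun y : R => y `^ (be + 1)) ((be + 1) * (c * x + t) `^ be).
  have i0 : (c * x + t) \in `]0, +oo[ by rewrite in_itv/= x0.
  have := @powR_derive1 R (be + 1) _ i0; rewrite addrK derive1E => <-.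
  by apply: DeriveDef => //; exact: derivable_powR.
have h3 := @is_derive1_comp R (fun y => y `^ (be + 1)) (fun x => c * x + t) x _ _ h2 h1.
have h4 := @is_deriveM R R^o _ _ x 1 _ _ h3 (is_derive_cst (c * (be + 1))^-1 x 1).
apply: (is_derive_eq h4).
rewrite /GRing.scale/= mulr0 add0r; field.
by apply/andP.
Qed.

(** Since be > -1, the antiderivative has a positive exponent and stays bounded. The two signs of
    [c] allow a singularity at the left or at the right end, as for |v| on either side of 0. *)
Lemma integral_powR_affine (be c t a b : R) : -1 < be -> be <= 0 -> c = 1 \/ c = -1 ->
  (forall x, a < x < b -> 0 < c * x + t <= 2) ->
  mu.-integrable setT (EFin \o ((fun x => (c * x + t) `^ be) \_ `]a, b[)).
Proof.
move=> be1 be0 hc xpos.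
have b10 : 0 < be + 1 by lra.
have c0 : c != 0 by case: hc => ->; rewrite ?oppr_eq0 oner_eq0.
have mf : measurable_fun setT (fun x : R => (c * x + t) `^ be).
  apply: (measurableT_comp (measurable_powR _)) => //.
  by apply: measurable_funD => //; exact: measurable_funM.
rewrite -restrict_EFin; apply/integrable_restrict => //=; rewrite setTI.
apply/integrableP; split; first by apply/measurable_EFinP; exact: measurable_funTS.
under eq_integral do rewrite /= ger0_norm ?powR_ge0//.
pose K := 2 `^ (be + 1) / (be + 1).
have Kge x : a < x < b -> 0 <= (c * x + t) `^ (be + 1) / (be + 1) <= K.
  move=> /xpos/andP[h1 h2].
  rewrite divr_ge0 ?powR_ge0 ?(ltW b10)//= ler_wpM2r ?invr_ge0 ?(ltW b10)//.
  by apply: ge0_ler_powR; rewrite ?nnegrE ?(ltW b10) ?(ltW h1).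
have K0 : 0 <= K by rewrite divr_ge0 ?powR_ge0 ?(ltW b10).
have cont x : a < x < b -> {for x, continuous (fun x => (c * x + t) `^ be)}.
  move=> /xpos/andP[h1 _].
  apply: (@continuous_comp _ _ _ (fun x : R => c * x + t) (fun y => y `^ be)).
    apply: cvgD; last exact: cvg_cst.
    by apply: cvgM; [exact: cvg_cst|exact: cvg_id].
  apply/differentiable_continuous/derivable1_diffP.
  by apply: derivable_powR; rewrite in_itv/= h1.
have f0 x : a < x < b -> 0 <= (c * x + t) `^ be by rewrite powR_ge0.
have dF x : a < x < b ->
  is_derive x 1 (fun x => (c * x + t) `^ (be + 1) / (c * (be + 1))) ((c * x + t) `^ be).
  move=> /xpos/andP[h1 _]; apply: is_derive_powR_affine => //; exact: lt0r_neq0.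
case: hc => e; rewrite e in dF cont f0 Kge *.
  apply: le_lt_trans (ltry K).
  apply: (ge0_FTC2_oo_le _ (fun x => (1 * x + t) `^ (be + 1) / (1 * (be + 1)))) => //.
  by move=> x /Kge; rewrite [1 * (be + 1)]mul1r.
apply: le_lt_trans (ltry K).
(* For c = -1 the natural antiderivative lies in [-K, 0]; adding [K] moves it into [0, K]. *)
apply: (ge0_FTC2_oo_le _ (fun x => K + (-1 * x + t) `^ (be + 1) / (-1 * (be + 1)))) => //.
  move=> x xab.
  have h := is_deriveD (is_derive_cst K x 1) (dF x xab).
  by apply: (is_derive_eq h); rewrite add0r.
move=> x /Kge; rewrite [-1 * (be + 1)]mulN1r invrN mulrN => /andP[h1 h2].
by apply/andP; split; lra.
Qed.

End ImproperPower.

(** * Integrability on the disk *)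

Section Integrability.
Context {R : realType}.
Notation mu := (@lebesgue_measure R).
Local Notation A := (@areaR R).
Local Notation D := (@diskR R).

Local Notation TT := (measurableTypeR R * measurableTypeR R)%type.

Lemma measurable_x : measurable_fun [set: TT] (fun p : TT => p.1 : R).
Proof. exact: measurable_fst. Qed.

Lemma measurable_y : measurable_fun [set: TT] (fun p : TT => p.2 : R).
Proof. exact: measurable_snd. Qed.

Lemma measurable_EFin d (T : measurableType d) (B : set T) (G : T -> R) :
  measurable_fun B G -> measurable_fun B (fun p => (G p)%:E).
Proof. by move=> h; apply/(@measurable_EFinP _ T R B G). Qed.

Lemma integrable_tensor (f g : R -> R) : mu.-integrable setT (EFin \o f) ->
  mu.-integrable setT (EFin \o g) ->
  A.-integrable setT (fun p => (f p.1 * g p.2)%:E).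
Proof.
move=> fi gi; have mf := measurable_int _ fi; have mg := measurable_int _ gi.
have mf' := (measurable_EFinP _ _).1 mf.
have mg' := (measurable_EFinP _ _).1 mg.
apply/integrable12ltyP.
  apply: (@measurable_EFin _ TT); apply: measurable_funM.
    exact: (measurableT_comp mf' measurable_x).
  exact: (measurableT_comp mg' measurable_y).
have gfin : (\int[mu]_y `|(g y)%:E|)%E \is a fin_num.
  by rewrite ge0_fin_numE ?integral_ge0//; have /integrableP[] := gi.
have inner x : (\int[mu]_y `|(f x * g y)%:E| = `|(f x)%:E| * \int[mu]_y `|(g y)%:E|)%E.
  rewrite -ge0_integralZl//; last exact: measurableT_comp.
  by apply: eq_integral => y _; rewrite -abseM -EFinM.
under eq_integral do rewrite /= inner.
rewrite ge0_integralZr//; last 2 first.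
- exact: measurableT_comp.
- by apply: integral_ge0.
rewrite lte_mul_pinfty//.
- exact: integral_ge0.
- by rewrite ge0_fin_numE ?integral_ge0//; have /integrableP[] := fi.
- by have /integrableP[] := gi.
Qed.

Definition wgt (p : R * R) : R := 1 - p.1 ^+ 2 - p.2 ^+ 2.
Definition nrm1 (p : R * R) : R := (p.1 + 1) ^+ 2 + p.2 ^+ 2.

Lemma measurable_wgt : measurable_fun [set: TT] wgt.
Proof.
apply: measurable_funB; [apply: measurable_funB => //|]; apply: measurable_funX.
  exact: measurable_x.
exact: measurable_y.
Qed.

Lemma measurable_nrm1 : measurable_fun [set: TT] nrm1.
Proof.
apply: measurable_funD; apply: measurable_funX; last exact: measurable_y.
by apply: measurable_funD => //; exact: measurable_x.
Qed.

Lemma measurable_log_abs_xp1 : measurable_fun [set: TT] (@log_abs_xp1 R).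
Proof.
apply: (measurableT_comp (@measurable_ln R)).
apply: (measurableT_comp (continuous_measurable_fun (@sqrt_continuous R))).
exact: measurable_nrm1.
Qed.

Lemma measurable_disk : measurable (D : set TT).
Proof.
have -> : D = wgt @^-1` `[0, +oo[%classic.
  apply/seteqP; split => p; rewrite /diskR/wgt/= in_itv/= andbT => h; lra.
rewrite -[X in measurable X]setTI; exact: measurable_wgt.
Qed.

Lemma nrm1_ge p : `|p.1 + 1| * `|p.2| <= nrm1 p.
Proof.
rewrite /nrm1 -[(p.1 + 1) ^+ 2]real_normK ?num_real// -[p.2 ^+ 2]real_normK ?num_real//.
by have := normr_ge0 (p.1 + 1); have := normr_ge0 p.2; nra.
Qed.

Lemma areaR_line (N : set (measurableTypeR R)) : measurable N -> mu N = 0%E ->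
  A (setT `*` N) = 0%E /\ A (N `*` setT) = 0%E.
Proof.
move=> mN N0; rewrite /areaR; split.
  transitivity (mu setT * mu N)%E; last by rewrite N0 mule0.
  exact: product_measure1E.
transitivity (mu N * mu setT)%E; last by rewrite N0 mul0e.
exact: product_measure1E.
Qed.

(* By AM-GM |1+x|^2 >= |u+1| |v|, so |1+x|^al is dominated by a product of two
   one-variable powers with exponent al/2 > -1. *)
Lemma integrable_disk (al C : R) (G : R * R -> R) : -2 < al -> al <= 0 -> 0 <= C ->
  measurable_fun [set: TT] G ->
  (forall p, D p -> p.2 != 0 -> `|G p| <= C * nrm1 p `^ (al / 2)) ->
  A.-integrable D (EFin \o G).
Proof.
move=> al2 al0 C0 mG hG.
have be1 : -1 < al / 2 by lra.
have be0 : al / 2 <= 0 by lra.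
pose f1 : R -> R := (fun x => (1 * x + 1) `^ (al / 2)) \_ `]-1, 1[.
pose f2 : R -> R := (fun x => (1 * x + 0) `^ (al / 2)) \_ `]0, 2[.
pose f3 : R -> R := (fun x => (-1 * x + 0) `^ (al / 2)) \_ `]-2, 0[.
have i1 : mu.-integrable setT (EFin \o f1).
  by apply: integral_powR_affine => //; [left|move=> x /andP[]; lra].
have i2 : mu.-integrable setT (EFin \o f2).
  by apply: integral_powR_affine => //; [left|move=> x /andP[]; lra].
have i3 : mu.-integrable setT (EFin \o f3).
  by apply: integral_powR_affine => //; [right|move=> x /andP[]; lra].
have i23 : mu.-integrable setT (EFin \o (f2 \+ f3)).
  by rewrite (_ : _ \o _ = (EFin \o f2) \+ (EFin \o f3))%E//; exact: integrableD.
have i123 := integrable_tensor _ _ i1 i23.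
(* On the line v = 0 the dominating product is 0, because [f2] and [f3] are supported on open
   intervals that exclude 0. This null line is removed. *)
pose N : set TT := setT `*` [set 0].
have [N0 _] : A N = 0%E /\ _ := areaR_line [set 0] (measurable_set1 0) (lebesgue_measure_set1 0).
have mN : measurable N by apply: measurableX.
have mD := measurable_disk.
have mGD : measurable_fun (D : set TT) (EFin \o G).
  by apply: (@measurable_EFin _ TT); exact: measurable_funTS.
apply/(negligible_integrable mN mD mGD N0).
have mDN : measurable (D `\` N : set TT) by exact: measurableD.
have : A.-integrable (D `\` N) (fun p => (C * (f1 p.1 * (f2 \+ f3) p.2))%:E).
  have i4 := integrableS measurableT mDN (@subsetT _ _) i123.
  by apply: (eq_integrable _ _ _ _ (integrableZl mDN C i4)) => // p _; rewrite /= -EFinM.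
apply: le_integrable => //.
  by apply: (@measurable_EFin _ TT); exact: measurable_funTS.
move=> p [Dp Np]; have p2 : p.2 != 0.
  by apply/eqP => p2; apply: Np; split.
rewrite /= lee_fin; apply: (le_trans (hG p Dp p2)).
apply: (le_trans _ (ler_norm _)); apply: ler_wpM2l => //.
move: Dp; rewrite /diskR/= => Dp.
have sp2 : 0 < p.2 ^+ 2 by rewrite exprn_even_gt0.
have p1 : -1 < p.1 < 1 by apply/andP; split; nra.
have n0 : 0 < `|p.1 + 1| * `|p.2|.
  by rewrite mulr_gt0// normr_gt0// gt_eqF//; lra.
apply: (le_trans (powR_le_neg _ _ _ n0 (nrm1_ge p) be0)).
rewrite powRM// /f1 patchE mem_set/=; last by rewrite in_itv/=.
rewrite mul1r ger0_norm; last by lra.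
apply: ler_wpM2l; first exact: powR_ge0.
rewrite /f2 /f3 !patchE.
have [p20|p20|//] := ltgtP p.2 0; last by move/eqP: p2.
  rewrite memNset/=; last by rewrite in_itv/=; apply/negP; rewrite negb_and -leNgt (ltW p20).
  rewrite mem_set/=; last by rewrite in_itv/= p20 andbT; nra.
  by rewrite add0r mulN1r addr0 ltr0_norm.
rewrite mem_set/=; last by rewrite in_itv/= p20; nra.
rewrite memNset/=; last by rewrite in_itv/=; apply/negP; rewrite negb_and -!leNgt (ltW p20) orbT.
by rewrite !addr0 mul1r gtr0_norm.
Qed.

End Integrability.

(** * Vanishing of slice-derivative integrals by Fubini *)

Section Divergence.
Context {R : realType}.
Notation mu := (@lebesgue_measure R).
Local Notation A := (@areaR R).
Local Notation D := (@diskR R).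
Local Notation TT := (measurableTypeR R * measurableTypeR R)%type.

(** Horizontally, the slice at v = 0 ends at x = -1 and those at v = 1 and v = -1 are single points;
    vertically, the slice at u = -1 is the point x = -1 itself. *)
Lemma lebesgue_measure_slice_exceptions : mu ([set 0] `|` [set 1] `|` [set -1]) = 0%E.
Proof.
apply: countable_lebesgue_measure0; apply: finite_set_countable.
by rewrite !finite_setU; split; [split|]; exact: finite_set1.
Qed.

Lemma slice_disk (c x : R) : `|c| <= 1 ->
  (c ^+ 2 + x ^+ 2 <= 1) = (x \in `[- Num.sqrt (1 - c ^+ 2), Num.sqrt (1 - c ^+ 2)]).
Proof.
move=> c1; have c2 : 0 <= 1 - c ^+ 2.
  by rewrite -real_normK ?num_real// subr_ge0 expr_le1.
rewrite in_itv/= -ler_norml -sqrtr_sqr ler_psqrt ?nnegrE ?sqr_ge0//.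
by rewrite lerBrDl.
Qed.

Lemma integral_disk_x (G : TT -> R) : A.-integrable D (EFin \o G) ->
  (forall y, y != 0 -> `|y| < 1 ->
    (\int[mu]_(x in [set` `[- Num.sqrt (1 - y ^+ 2), Num.sqrt (1 - y ^+ 2)]%R]) (G (x, y))%:E = 0)%E) ->
  (\int[A]_(p in D) (G p)%:E = 0)%E.
Proof.
move=> iG h; pose S : set (measurableTypeR R) := [set 0] `|` [set 1] `|` [set -1].
pose N : set TT := setT `*` S.
have mS : measurable S by apply: measurableU; [apply: measurableU|].
have [N0 _] := areaR_line S mS lebesgue_measure_slice_exceptions.
have mN : measurable N by exact: measurableX.
have mD : measurable (D : set TT) by exact: measurable_disk.
have mDN : measurable (D `\` N : set TT) by exact: measurableD.
rewrite (negligible_integral mN mD iG N0) integral_mkcond.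
have iDN : A.-integrable [set: TT] ((EFin \o G) \_ (D `\` N)).
  apply/(integrable_restrict A mDN (@measurableT _ TT)); rewrite setTI.
  by apply: integrableS iG => //; exact: subDsetl.
rewrite -(integral21_prod_meas1 iDN).
apply: integral0_eq => y _; rewrite /fubini_G.
have [yS|yS] := pselect (S y).
  by apply: integral0_eq => x _; rewrite patchE memNset// => -[_]; apply; split.
have y0 : y != 0 by apply/eqP => y0; apply: yS; left; left.
have [y1|y1] := ltP `|y| 1; last first.
  apply: integral0_eq => x _; rewrite patchE memNset// => -[+ _].
  rewrite /diskR/= => xy.
  have : y ^+ 2 = 1.
    have := sqr_ge0 x; rewrite -[y ^+ 2]real_normK ?num_real// in xy *; nra.
  by move=> /eqP; rewrite sqrf_eq1 => /orP[/eqP e|/eqP e]; apply: yS; [left; right|right].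
rewrite -[RHS](h y y0 y1) [RHS]integral_mkcond; apply: eq_integral => x _.
rewrite !patchE; congr (if _ then _ else _).
apply/idP/idP; rewrite !inE.
  by move=> [+ _]; rewrite /diskR/= addrC (slice_disk _ _ (ltW y1)).
move=> hx; split; first by rewrite /diskR/= addrC (slice_disk _ _ (ltW y1)).
by move=> [_ ?].
Qed.

Lemma integral_disk_y (G : TT -> R) : A.-integrable D (EFin \o G) ->
  (forall x, `|x| < 1 ->
    (\int[mu]_(y in [set` `[- Num.sqrt (1 - x ^+ 2), Num.sqrt (1 - x ^+ 2)]%R]) (G (x, y))%:E = 0)%E) ->
  (\int[A]_(p in D) (G p)%:E = 0)%E.
Proof.
move=> iG h; pose S : set (measurableTypeR R) := [set 0] `|` [set 1] `|` [set -1].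
pose N : set TT := S `*` setT.
have mS : measurable S by apply: measurableU; [apply: measurableU|].
have [_ N0] := areaR_line S mS lebesgue_measure_slice_exceptions.
have mN : measurable N by exact: measurableX.
have mD : measurable (D : set TT) by exact: measurable_disk.
have mDN : measurable (D `\` N : set TT) by exact: measurableD.
rewrite (negligible_integral mN mD iG N0) integral_mkcond.
have iDN : A.-integrable [set: TT] ((EFin \o G) \_ (D `\` N)).
  apply/(integrable_restrict A mDN (@measurableT _ TT)); rewrite setTI.
  by apply: integrableS iG => //; exact: subDsetl.
rewrite -(integral12_prod_meas1 iDN).
apply: integral0_eq => x _; rewrite /fubini_F.
have [xS|xS] := pselect (S x).
  by apply: integral0_eq => y _; rewrite patchE memNset// => -[_]; apply; split.
have [x1|x1] := ltP `|x| 1; last first.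
  apply: integral0_eq => y _; rewrite patchE memNset// => -[+ _].
  rewrite /diskR/= => xy.
  have : x ^+ 2 = 1.
    have := sqr_ge0 y; rewrite -[x ^+ 2]real_normK ?num_real// in xy *; nra.
  by move=> /eqP; rewrite sqrf_eq1 => /orP[/eqP e|/eqP e]; apply: xS; [left; right|right].
rewrite -[RHS](h x x1) [RHS]integral_mkcond; apply: eq_integral => y _.
rewrite !patchE; congr (if _ then _ else _).
apply/idP/idP; rewrite !inE.
  by move=> [+ _]; rewrite /diskR/= (slice_disk _ _ (ltW x1)).
move=> hx; split; first by rewrite /diskR/= (slice_disk _ _ (ltW x1)).
by move=> [? _].
Qed.

Variables (phi psi : R -> R).
Hypothesis hphi : forall x : R, is_derive x 1 phi (psi x).
Hypothesis cpsi : continuous psi.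

Lemma divergence_x_eq0 (k : nat) (m : R) :
  let G := fun p : TT => slice_deriv phi psi k (1 - p.2 ^+ 2) 1 (p.2 ^+ 2) m p.1 in
  A.-integrable D (EFin \o G) -> (\int[A]_(p in D) (G p)%:E = 0)%E.
Proof.
move=> G iG; apply: integral_disk_x => // y y0 y1.
have c2 : 0 < 1 - y ^+ 2.
  by rewrite -real_normK ?num_real// subr_gt0 expr_lt1.
have r0 : 0 < Num.sqrt (1 - y ^+ 2) by rewrite sqrtr_gt0.
have := @slice_integral0 R phi psi hphi cpsi k _ 1 (y ^+ 2) m r0.
rewrite sqr_sqrtr ?(ltW c2)//; apply => t _.
by rewrite ltr_wpDl ?sqr_ge0// exprn_even_gt0.
Qed.

Lemma divergence_y_eq0 (k : nat) (m : R) :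
  let G := fun p : TT => slice_deriv phi psi k (1 - p.1 ^+ 2) 0 ((p.1 + 1) ^+ 2) m p.2 in
  A.-integrable D (EFin \o G) -> (\int[A]_(p in D) (G p)%:E = 0)%E.
Proof.
move=> G iG; apply: integral_disk_y => // x x1.
have c2 : 0 < 1 - x ^+ 2.
  by rewrite -real_normK ?num_real// subr_gt0 expr_lt1.
have r0 : 0 < Num.sqrt (1 - x ^+ 2) by rewrite sqrtr_gt0.
have := @slice_integral0 R phi psi hphi cpsi k _ 0 ((x + 1) ^+ 2) m r0.
rewrite sqr_sqrtr ?(ltW c2)//; apply => t _.
rewrite ltr_wpDl ?sqr_ge0// exprn_even_gt0//=.
by move: x1; rewrite ltr_norml => /andP[? _]; rewrite gt_eqF//; lra.
Qed.

End Divergence.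

(** * Area of the unit disk *)

Section Area.
Context {R : realType}.
Notation mu := (@lebesgue_measure R).
Local Notation A := (@areaR R).
Local Notation D := (@diskR R).
Local Notation TT := (measurableTypeR R * measurableTypeR R)%type.

(* 2 atan (v / (1 + sqrt (1 - v^2))) is asin v, in a form whose continuity at
   v = 1 and v = -1 is immediate. *)
Lemma is_derive_half_disk (v : R) : -1 < v < 1 ->
  is_derive v 1 (fun v => v * Num.sqrt (1 - v ^+ 2) + 2 * atan (v / (1 + Num.sqrt (1 - v ^+ 2))))
    (2 * Num.sqrt (1 - v ^+ 2)).
Proof.
move=> /andP[v1 v2]; have c0 : 0 < 1 - v ^+ 2 by nra.
set c := Num.sqrt (1 - v ^+ 2).
have cp : 0 < c by rewrite sqrtr_gt0.
have cc : c ^+ 2 = 1 - v ^+ 2 by rewrite sqr_sqrtr// ltW.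
have h1 : is_derive v 1 (fun v : R => 1 - v ^+ 2) (- (2 * v)).
  by apply: is_derive_eq; rewrite /GRing.scale/=; ring.
have h2 : is_derive v 1 (fun v : R => Num.sqrt (1 - v ^+ 2)) ((2 * c)^-1 * (- (2 * v))).
  exact: (@is_derive1_comp R (@Num.sqrt R) (fun v : R => 1 - v ^+ 2) v _ _ (is_derive1_sqrt c0) h1).
have h3 : is_derive v 1 (fun v : R => (1 + Num.sqrt (1 - v ^+ 2))^-1)
    (- (1 + c) ^- 2 *: (0 + (2 * c)^-1 * (- (2 * v)))).
  apply: (@is_deriveV R (fun v : R => 1 + Num.sqrt (1 - v ^+ 2))).
  by rewrite gt_eqF// addr_gt0.
apply: is_derive_eq.
rewrite /GRing.scale/= -/c add0r !mulr1.
have vv : v ^+ 2 = 1 - c ^+ 2 by rewrite cc; ring.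
(* Half-angle formula: for v = sin(theta) and c = cos(theta), v/(1 + c) is tan(theta/2), and the
   left side is cos(theta/2)^2. *)
have -> : (1 + (v / (1 + c)) ^+ 2)^-1 = (1 + c) / 2.
  rewrite expr_div_n vv; field.
  by rewrite !gt_eqF//; nra.
have -> : v * ((2 * c)^-1 * - (2 * v)) + c = (2 * c ^+ 2 - 1) / c.
  rewrite (_ : v * _ = - (v ^+ 2 / c)); last by field; rewrite gt_eqF.
  by rewrite vv; field; rewrite gt_eqF.
rewrite (_ : v * (- (1 + c) ^- 2 * ((2 * c)^-1 * - (2 * v))) + (1 + c)^-1 =
  v ^+ 2 / (c * (1 + c) ^+ 2) + (1 + c)^-1); last by field; rewrite !gt_eqF// addr_gt0.
by rewrite vv; field; rewrite !gt_eqF// addr_gt0.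
Qed.

Lemma integral_half_disk :
  (\int[mu]_(x in `[(-1)%R, 1%R]) (2 * Num.sqrt (1 - x ^+ 2))%:E = pi%:E)%E.
Proof.
have cs (v : R) : {for v, continuous (fun v : R => Num.sqrt (1 - v ^+ 2))}.
  apply: (@continuous_comp _ _ _ (fun v : R => 1 - v ^+ 2) (@Num.sqrt R)); last exact: sqrt_continuous.
  by apply: cvgB; [exact: cvg_cst|exact: exprn_continuous].
pose F (v : R) := v * Num.sqrt (1 - v ^+ 2) + 2 * atan (v / (1 + Num.sqrt (1 - v ^+ 2))).
have cF (v : R) : {for v, continuous F}.
  apply: cvgD.
    by apply: cvgM; [exact: cvg_id|exact: cs].
  apply: cvgM; first exact: cvg_cst.
  apply: (@continuous_comp _ _ _ (fun v : R => v / (1 + Num.sqrt (1 - v ^+ 2))) (@atan R)); last exact: continuous_atan.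
  apply: cvgM; first exact: cvg_id.
  apply: (@continuousV _ _ (fun v : R => 1 + Num.sqrt (1 - v ^+ 2))).
    by rewrite gt_eqF// ltr_pwDl// sqrtr_ge0.
  by apply: cvgD; [exact: cvg_cst|exact: cs].
have l11 : -1 < 1 :> R by lra.
have cFw : {within `[-1, 1], continuous F} by apply: continuous_in_subspaceT => x _; exact: cF.
rewrite (@continuous_FTC2 _ _ F)//.
- rewrite /F sqrrN expr1n subrr sqrtr0 mulr0 mulr0 add0r add0r addr0 !divr1 atanN atan1.
  by rewrite -EFinB; congr EFin; field.
- apply: continuous_in_subspaceT => x _.
  by apply: cvgM; [exact: cvg_cst|exact: cs].
- move/(continuous_within_itvP _ l11) : cFw => [_ c1 c2].
  by split => // t; rewrite in_itv/= => /is_derive_half_disk [].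
- by move=> t; rewrite in_itv/= => /is_derive_half_disk [? <-]; rewrite derive1E.
Qed.

(** Base case of the normalisation [integral_wgtX]. *)
Lemma area_disk : (A D = pi%:E)%E.
Proof.
have mD : measurable (D : set TT) by exact: measurable_disk.
have -> : A D = (\int[A]_p (\1_D p)%:E)%E by rewrite integral_indic// setIT.
have m1 : measurable_fun [set: TT] (fun p => (\1_D p)%:E : \bar R).
  by apply: (@measurable_EFin _ _ TT); exact: measurable_indic.
rewrite /areaR fubini_tonelli1//.
rewrite -integral_half_disk [RHS]integral_mkcond; apply: eq_integral => x _.
rewrite /fubini_F patchE; case: ifPn => [|].
  rewrite inE/= in_itv/= -ler_norml => x1.
  transitivity (\int[mu]_y (\1_[set` `[- Num.sqrt (1 - x ^+ 2), Num.sqrt (1 - x ^+ 2)]%R] y)%:E)%E.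
    apply: eq_integral => y _; congr EFin; rewrite !indicE; congr (nat_of_bool _)%:R.
    by apply/idP/idP; rewrite !inE /diskR/= (slice_disk _ _ x1).
  rewrite integral_indic// setIT /= lebesgue_measure_itv/= lte_fin.
  have := sqrtr_ge0 (1 - x ^+ 2); set r := Num.sqrt _.
  rewrite le_eqVlt => /orP[/eqP <-|r0]; first by rewrite oppr0 ltxx mulr0.
  by rewrite gtrN// -EFinB; congr EFin; ring.
move=> /negP; rewrite inE/= in_itv/= -ler_norml => x1.
apply: integral0_eq => y _; congr EFin; rewrite indicE memNset// /diskR/= => xy.
apply: x1; rewrite -(@expr_le1 _ 2)// real_normK ?num_real//.
by have := sqr_ge0 y; lra.
Qed.

End Area.

(** * Growth bounds near the singular point *)

Section Bounds.
Context {R : realType}.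
Notation mu := (@lebesgue_measure R).
Local Notation A := (@areaR R).
Local Notation D := (@diskR R).
Local Notation TT := (measurableTypeR R * measurableTypeR R)%type.
Local Notation L := (@log_abs_xp1 R).
Local Notation I f := (Rintegral A D f).

Lemma nrm1_gt0 (p : R * R) : p.2 != 0 -> 0 < nrm1 p.
Proof. by move=> p2; rewrite /nrm1 ltr_wpDl ?sqr_ge0// exprn_even_gt0. Qed.

Lemma expR_log (al : R) (p : R * R) : 0 < nrm1 p -> expR (al * L p) = nrm1 p `^ (al / 2).
Proof.
move=> q0; rewrite /log_abs_xp1 -/(nrm1 p) -powR12_sqrt ?(ltW q0)// ln_powR /powR gt_eqF//.
by congr expR; ring.
Qed.

Lemma expRN2_log (p : R * R) : 0 < nrm1 p -> expR (- 2 * L p) = (nrm1 p)^-1.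
Proof.
move=> q0; rewrite expR_log// (_ : - 2 / 2 = -1); last by field.
by rewrite powR_inv1// ltW.
Qed.

Lemma log_le1 (p : R * R) : D p -> L p <= 1.
Proof.
rewrite /diskR/= => Dp.
have [q0|q0] := ltP 0 (nrm1 p); last first.
  by rewrite /log_abs_xp1 -/(nrm1 p) ler0_sqrtr// ln0.
have s0 : 0 < Num.sqrt (nrm1 p) by rewrite sqrtr_gt0.
have s2 : Num.sqrt (nrm1 p) <= 2.
  rewrite -(@ler_pXn2r _ 2)// ?nnegrE ?(ltW s0)// sqr_sqrtr ?(ltW q0)// /nrm1.
  by have := sqr_ge0 p.2; nra.
have := @le_ln1Dx R (Num.sqrt (nrm1 p) - 1).
rewrite /log_abs_xp1 -/(nrm1 p) [1 + _]addrC subrK => h.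
apply: (le_trans (h _)); lra.
Qed.

Lemma wgt01 (p : R * R) : D p -> 0 <= wgt p <= 1.
Proof.
rewrite /diskR/wgt/= => Dp; have := sqr_ge0 p.1; have := sqr_ge0 p.2.
by move=> h1 h2; apply/andP; split; lra.
Qed.

(** Geometrically, w = (1 - |x|)(1 + |x|) <= 2 (1 - |x|) <= 2 |1+x|. This is the estimate that tames
    |1+x|^-2. *)
Lemma wgt_sq_le (p : R * R) : D p -> wgt p ^+ 2 <= 4 * nrm1 p.
Proof.
move=> Dp; have /andP[w0 w1] := wgt01 p Dp.
have e : nrm1 p = 2 + 2 * p.1 - wgt p by rewrite /nrm1 /wgt; ring.
have e2 : wgt p = 1 - p.1 ^+ 2 - p.2 ^+ 2 by [].
have := sqr_ge0 p.2; rewrite e; set w := wgt p in w0 w1 e2 *; move=> y0.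
have : p.1 ^+ 2 <= 1 - w by rewrite e2; lra.
move: (p.1) => u h.
(* With a = u + 1, |1+x|^2 = 2a - w >= a^2 by [h]; since a^2 >= 0 this forces a >= w/2, hence 2a - w
   >= a^2 >= w^2/4. *)
have h1 := sqr_ge0 (u + 1 - w / 2).
have h2 := sqr_ge0 (u + 1).
nra.
Qed.

(** By [log_le1] the half-line x <= 1 contains all values of log |1+x| on the disk, so the
    exponential bound on [f] becomes the power bound of [integrable_disk]. *)
Lemma integrable_log (al C M : R) (f : R -> R) (h : TT -> R) :
  -2 < al -> al <= 0 -> 0 <= C -> 0 <= M ->
  continuous f -> (forall x, x <= 1 -> `|f x| <= C * expR (al * x)) ->
  measurable_fun [set: TT] h ->
  (forall p, D p -> p.2 != 0 -> `|h p| <= M) ->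
  A.-integrable D (EFin \o (fun p : TT => h p * f (L p))).
Proof.
move=> al2 al0 C0 M0 cf fb mh hb.
apply: (@integrable_disk R al (M * C)) => //; first exact: mulr_ge0.
  apply: measurable_funM => //.
  apply: (measurableT_comp (continuous_measurable_fun cf)).
  exact: measurable_log_abs_xp1.
move=> p Dp p2; rewrite normrM -mulrA -expR_log ?nrm1_gt0//.
by apply: ler_pM => //; [exact: hb|apply: fb; exact: log_le1].
Qed.

Lemma measurable_Einv : measurable_fun [set: TT] (fun p : TT => expR (- 2 * L p)).
Proof.
apply: (measurableT_comp (@measurable_expR R)); apply: measurable_funM => //.
exact: measurable_log_abs_xp1.
Qed.

Lemma measurable_wgtX k : measurable_fun [set: TT] (fun p : TT => wgt p ^+ k).
Proof. by apply: measurable_funX; exact: measurable_wgt. Qed.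

Lemma wgtX_le1 k (p : R * R) : D p -> 0 <= wgt p ^+ k <= 1.
Proof. by move=> /wgt01/andP[w0 w1]; rewrite exprn_ge0// exprn_ile1. Qed.

(** Two powers of the weight absorb |1+x|^-2; hence the exponent k + 2 in the second field. *)
Lemma wgt_Einv_le k (p : R * R) : D p -> p.2 != 0 ->
  0 <= wgt p ^+ k.+2 * expR (- 2 * L p) <= 4.
Proof.
move=> Dp p2; have q0 := nrm1_gt0 p p2; rewrite expRN2_log//.
have /andP[w0 w1] := wgtX_le1 k.+2 p Dp; have /andP[v0 v1] := wgtX_le1 k p Dp.
rewrite mulr_ge0 ?invr_ge0 ?(ltW q0)//= ler_pdivrMr// -addn2 exprD.
by have := wgt_sq_le p Dp; have := sqr_ge0 (wgt p); nra.
Qed.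

Section Growth.
Variables (phi psi : R -> R) (al C : R).
Hypothesis hphi : forall x : R, is_derive x 1 phi (psi x).
Hypothesis cpsi : continuous psi.
Hypothesis al2 : -2 < al.
Hypothesis al0 : al <= 0.
Hypothesis C0 : 0 <= C.
Hypothesis phib : forall x, x <= 1 -> `|phi x| <= C * expR (al * x).
Hypothesis psib : forall x, x <= 1 -> `|psi x| <= C * expR (al * x).

Let cphi : continuous phi.
Proof. by move=> x; exact: is_derive_continuous (hphi x). Qed.

Lemma integrable_wgt k : A.-integrable D (EFin \o (fun p : TT => wgt p ^+ k * phi (L p))).
Proof.
apply: (integrable_log al C 1) => //; first exact: measurable_wgtX.
by move=> p Dp _; have /andP[h1 h2] := wgtX_le1 k p Dp; rewrite ger0_norm.
Qed.

Lemma integrable_wgt_Einv k : A.-integrable D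
  (EFin \o (fun p : TT => wgt p ^+ k.+2 * expR (- 2 * L p) * phi (L p))).
Proof.
apply: (integrable_log al C 4) => //.
  by apply: measurable_funM; [exact: measurable_wgtX|exact: measurable_Einv].
by move=> p Dp p2; have /andP[h1 h2] := wgt_Einv_le k p Dp p2; rewrite ger0_norm.
Qed.

End Growth.
End Bounds.

(** * The two divergence recurrences *)

Section Recurrence.
Context {R : realType}.
Notation mu := (@lebesgue_measure R).
Local Notation A := (@areaR R).
Local Notation D := (@diskR R).
Local Notation TT := (measurableTypeR R * measurableTypeR R)%type.
Local Notation L := (@log_abs_xp1 R).
Local Notation I f := (Rintegral A D f).
Local Notation int f := (A.-integrable D (EFin \o (f : TT -> R))).

Lemma disk_integrableZ (c : R) (f : TT -> R) : int f -> int (fun p => c * f p).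
Proof.
move=> fi; have h := integrableZl measurable_disk c fi.
by apply: (eq_integrable _ _ _ _ h) => [|p _]; [exact: measurable_disk|rewrite /= -EFinM].
Qed.

Lemma disk_integrableD (f g : TT -> R) : int f -> int g -> int (fun p => f p + g p).
Proof.
move=> fi gi; have h := integrableD measurable_disk fi gi.
by apply: (eq_integrable _ _ _ _ h) => [|p _]; [exact: measurable_disk|rewrite /= -EFinD].
Qed.

Lemma Rintegral_lin4 (a1 a2 a3 a4 : R) (f1 f2 f3 f4 : TT -> R) :
  int f1 -> int f2 -> int f3 -> int f4 ->
  I (fun p => a1 * f1 p + a2 * f2 p + (a3 * f3 p + a4 * f4 p)) =
  a1 * I f1 + a2 * I f2 + (a3 * I f3 + a4 * I f4).
Proof.
move=> i1 i2 i3 i4; have mD : measurable (D : set TT) by exact: measurable_disk.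
have j1 := disk_integrableZ a1 _ i1; have j2 := disk_integrableZ a2 _ i2; have j3 := disk_integrableZ a3 _ i3; have j4 := disk_integrableZ a4 _ i4.
rewrite (RintegralD mD (disk_integrableD _ _ j1 j2) (disk_integrableD _ _ j3 j4)).
by rewrite (RintegralD mD j1 j2) (RintegralD mD j3 j4) !RintegralZl.
Qed.

Lemma slice_x (phi psi : R -> R) (k : nat) (m : R) (p : R * R) :
  slice_deriv phi psi k (1 - p.2 ^+ 2) 1 (p.2 ^+ 2) m p.1 =
  (k.+1%:R * wgt p ^+ k * (- 2 * p.1) * (p.1 + m) + wgt p ^+ k.+1) * phi (L p) +
  wgt p ^+ k.+1 * ((p.1 + 1) * (p.1 + m) / nrm1 p) * psi (L p).
Proof.
rewrite /slice_deriv -/(nrm1 p) -/(L p) (_ : 1 - p.2 ^+ 2 - p.1 ^+ 2 = wgt p).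
  by set X := (nrm1 p)^-1; ring.
by rewrite /wgt; ring.
Qed.

Lemma slice_y (phi psi : R -> R) (k : nat) (p : R * R) :
  slice_deriv phi psi k (1 - p.1 ^+ 2) 0 ((p.1 + 1) ^+ 2) 0 p.2 =
  (k.+1%:R * wgt p ^+ k * (- 2 * p.2) * p.2 + wgt p ^+ k.+1) * phi (L p) +
  wgt p ^+ k.+1 * (p.2 * p.2 / nrm1 p) * psi (L p).
Proof.
rewrite /slice_deriv !addr0 (_ : p.2 ^+ 2 + (p.1 + 1) ^+ 2 = nrm1 p); last by rewrite addrC.
by rewrite -/(wgt p) /log_abs_xp1 -/(nrm1 p); set X := (nrm1 p)^-1; ring.
Qed.

Lemma measurable_nrm1V : measurable_fun [set: TT] (fun p : TT => (nrm1 p)^-1).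
Proof.
have -> : (fun p : TT => (nrm1 p)^-1) = (fun p : TT => nrm1 p `^ (-1)).
  by apply/funext => p; rewrite powR_inv1// /nrm1 addr_ge0 ?sqr_ge0.
apply: (measurableT_comp (measurable_powR _)); exact: measurable_nrm1.
Qed.

(* Used with t = u+1 and t = v, which compensate the singularity of 1/|1+x|^2. *)
Lemma wgt_ratio (p : R * R) (t : R) : D p -> p.2 != 0 -> t ^+ 2 <= nrm1 p ->
  `|wgt p * t / nrm1 p| <= 2 /\ t ^+ 2 / nrm1 p <= 1.
Proof.
move=> Dp p2 tq; have q0 := nrm1_gt0 p p2; have /andP[w0 w1] := wgt01 p Dp.
split; last by rewrite ler_pdivrMr// mul1r.
rewrite normrM [`|_^-1|]gtr0_norm ?invr_gt0// ler_pdivrMr//.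
rewrite -(@ler_pXn2r _ 2)// ?nnegrE ?mulr_ge0 ?(ltW q0)// real_normK ?num_real//.
have := wgt_sq_le p Dp; rewrite !exprMn; have := sqr_ge0 t; have := sqr_ge0 (wgt p); nra.
Qed.

Lemma disk_coord (p : R * R) : D p -> `|p.1| <= 1 /\ `|p.2| <= 1.
Proof.
rewrite /diskR/= => Dp; have := sqr_ge0 p.1; have := sqr_ge0 p.2 => h1 h2.
by split; rewrite -(@expr_le1 _ 2)// real_normK ?num_real//; lra.
Qed.

Lemma coord_le_nrm1 (p : R * R) : (p.1 + 1) ^+ 2 <= nrm1 p /\ p.2 ^+ 2 <= nrm1 p.
Proof. by rewrite /nrm1 lerDl lerDr !sqr_ge0. Qed.

Lemma norm_term_le (K W u t B : R) : 0 <= K -> `|W * u * t| <= B ->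
  `|K * W * (- 2 * u) * t| <= 2 * K * B.
Proof.
move=> K0 h; rewrite (_ : _ * t = - (2 * K) * (W * u * t)); last by ring.
have K2 : 0 <= 2 * K by rewrite mulr_ge0.
by rewrite normrM normrN (ger0_norm K2); exact: ler_wpM2l.
Qed.

Lemma prod3_le1 (a b c : R) : `|a| <= 1 -> `|b| <= 1 -> `|c| <= 1 -> `|a * b * c| <= 1.
Proof.
move=> h1 h2 h3; rewrite !normrM -[X in _ <= X]mulr1; apply: ler_pM => //.
by rewrite -[X in _ <= X]mulr1; apply: ler_pM.
Qed.

Variables (phi psi : R -> R) (al C : R).
Hypothesis hphi : forall x : R, is_derive x 1 phi (psi x).
Hypothesis cpsi : continuous psi.
Hypothesis al2 : -2 < al.
Hypothesis al0 : al <= 0.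
Hypothesis C0 : 0 <= C.
Hypothesis phib : forall x, x <= 1 -> `|phi x| <= C * expR (al * x).
Hypothesis psib : forall x, x <= 1 -> `|psi x| <= C * expR (al * x).

Let cphi : continuous phi.
Proof. by move=> x; exact: is_derive_continuous (hphi x). Qed.

Lemma integrable_comb (f g : R -> R) (h1 h2 : TT -> R) (C' M : R) : continuous f -> continuous g ->
  0 <= C' -> 0 <= M ->
  (forall x, x <= 1 -> `|f x| <= C' * expR (al * x)) ->
  (forall x, x <= 1 -> `|g x| <= C' * expR (al * x)) ->
  measurable_fun [set: TT] h1 -> measurable_fun [set: TT] h2 ->
  (forall p, D p -> p.2 != 0 -> `|h1 p| <= M) ->
  (forall p, D p -> p.2 != 0 -> `|h2 p| <= M) ->
  int (fun p => h1 p * f (L p) + h2 p * g (L p)).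
Proof.
by move=> cf cg C'0 M0 fb gb m1 m2 b1 b2; apply: disk_integrableD; apply: (integrable_log al C' M).
Qed.

Let mx := @measurable_x R.
Let my := @measurable_y R.

Local Ltac meas := repeat first [exact: mx | exact: my | exact: measurable_wgtX
  | exact: measurable_nrm1V | exact: measurable_Einv | exact: measurable_cst
  | apply: measurable_funM | apply: measurable_funD].

(** In the [psi] term (u+1)/|1+x|^2 alone is unbounded near x = -1; one factor w is paired with it,
    and [wgt_ratio] bounds the product by 2. *)
Lemma integrable_slice_x1 k :
  int (fun p : TT => slice_deriv phi psi k (1 - p.2 ^+ 2) 1 (p.2 ^+ 2) 0 p.1).
Proof.
rewrite (funext (slice_x phi psi k 0)).
apply: (integrable_comb phi psi _ _ C (2 * k.+1%:R + 2)) => //; try by meas.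
- move=> p Dp p2; have [u1 _] := disk_coord p Dp.
  have /andP[a0 a1] := wgtX_le1 k p Dp; have /andP[b0 b1] := wgtX_le1 k.+1 p Dp.
  rewrite addr0; apply: (le_trans (ler_normD _ _)).
  rewrite (ger0_norm b0); apply: lerD; last by lra.
  rewrite -[2 * _]mulr1; apply: norm_term_le => //.
  by apply: prod3_le1; rewrite ?(ger0_norm a0).
- move=> p Dp p2; have [u1 _] := disk_coord p Dp.
  have /andP[a0 a1] := wgtX_le1 k p Dp.
  have [t1 _] := wgt_ratio p _ Dp p2 (coord_le_nrm1 p).1.
  have k0 : 0 <= k.+1%:R :> R by [].
  rewrite addr0 (_ : _ * _ = wgt p ^+ k * p.1 * (wgt p * (p.1 + 1) / nrm1 p)); last first.
    by rewrite exprS; set X := (nrm1 p)^-1; ring.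
  rewrite normrM; apply: (@le_trans _ _ (1 * 2)); last by lra.
  apply: ler_pM => //; rewrite normrM (ger0_norm a0) -[1]mul1r; exact: ler_pM.
Qed.

Lemma integrable_slice_y1 k :
  int (fun p : TT => slice_deriv phi psi k (1 - p.1 ^+ 2) 0 ((p.1 + 1) ^+ 2) 0 p.2).
Proof.
rewrite (funext (slice_y phi psi k)).
apply: (integrable_comb phi psi _ _ C (2 * k.+1%:R + 2)) => //; try by meas.
- move=> p Dp p2; have [_ u1] := disk_coord p Dp.
  have /andP[a0 a1] := wgtX_le1 k p Dp; have /andP[b0 b1] := wgtX_le1 k.+1 p Dp.
  apply: (le_trans (ler_normD _ _)).
  rewrite (ger0_norm b0); apply: lerD; last by lra.
  rewrite -[2 * _]mulr1; apply: norm_term_le => //.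
  by apply: prod3_le1; rewrite ?(ger0_norm a0).
- move=> p Dp p2; have q0 := nrm1_gt0 p p2.
  have /andP[a0 a1] := wgtX_le1 k.+1 p Dp.
  have [_ t1] := wgt_ratio p _ Dp p2 (coord_le_nrm1 p).2.
  have k0 : 0 <= k.+1%:R :> R by [].
  have t0 : 0 <= p.2 ^+ 2 / nrm1 p by rewrite divr_ge0 ?sqr_ge0 ?(ltW q0).
  rewrite -expr2 ger0_norm; last exact: mulr_ge0.
  apply: (@le_trans _ _ (1 * 1)); last by lra.
  exact: ler_pM.
Qed.

(* Integral of the divergence of w^(k+1) phi(log |1+x|) x. *)
Lemma recurrence1 k :
  2 * k.+1%:R * I (fun p => wgt p ^+ k * phi (L p)) =
  (2 * k.+1%:R + 2) * I (fun p => wgt p ^+ k.+1 * phi (L p))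
  + 2^-1 * I (fun p => wgt p ^+ k.+1 * psi (L p))
  - 2^-1 * I (fun p => wgt p ^+ k.+2 * expR (- 2 * L p) * psi (L p)).
Proof.
have mD : measurable (D : set TT) by exact: measurable_disk.
have ix := integrable_slice_x1 k; have iy := integrable_slice_y1 k.
have ex : I (fun p => slice_deriv phi psi k (1 - p.2 ^+ 2) 1 (p.2 ^+ 2) 0 p.1) = 0.
  by rewrite /Rintegral (divergence_x_eq0 _ _ hphi cpsi).
have ey : I (fun p => slice_deriv phi psi k (1 - p.1 ^+ 2) 0 ((p.1 + 1) ^+ 2) 0 p.2) = 0.
  by rewrite /Rintegral (divergence_y_eq0 _ _ hphi cpsi).
have e0 := RintegralD mD ix iy; rewrite ex ey addr0 in e0.
have i1 := integrable_wgt phi psi al C hphi al2 al0 C0 phib k.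
have i2 := integrable_wgt phi psi al C hphi al2 al0 C0 phib k.+1.
have i3 : int (fun p => wgt p ^+ k.+1 * psi (L p)).
  apply: (integrable_log al C 1) => //; first exact: measurable_wgtX.
  by move=> p Dp _; have /andP[h1 h2] := wgtX_le1 k.+1 p Dp; rewrite ger0_norm.
have i4 : int (fun p => wgt p ^+ k.+2 * expR (- 2 * L p) * psi (L p)).
  apply: (integrable_log al C 4) => //; first by meas.
  by move=> p Dp p2; have /andP[h1 h2] := wgt_Einv_le k p Dp p2; rewrite ger0_norm.
(* The four coefficients come from |x|^2 = 1 - w and, for the real scalar product, x . (1+x) =
   (|1+x|^2 - w)/2, inserted in the divergence. *)
have := Rintegral_lin4 (- (2 * k.+1%:R)) (2 * k.+1%:R + 2) 2^-1 (- 2^-1) _ _ _ _ i1 i2 i3 i4.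
rewrite -(_ : 0 = I _); first by move=> h; lra.
rewrite -[LHS]e0; apply: eq_Rintegral => p; rewrite inE => Dp /=.
rewrite slice_x slice_y.
have [q0|q0] := ltP 0 (nrm1 p).
  rewrite expRN2_log// !exprS; move: q0; set W := wgt p ^+ k.
  set F := phi _; set G := psi _; rewrite /wgt /nrm1 => q0.
  by field; rewrite gt_eqF.
(* The integrands are compared at every point, hence also at x = -1, where [ln 0] and the inverse of
   0 take default values. There w = 0 and |x|^2 = 1, and [W] stays symbolic because it is 1 for k =
   0. *)
have w0 : wgt p = 0.
  have h := wgt_sq_le p Dp; apply/eqP; rewrite -sqrf_eq0 eq_le sqr_ge0 andbT; lra.
have h : p.1 ^+ 2 + p.2 ^+ 2 = 1 by move: w0; rewrite /wgt; lra.
rewrite [wgt p ^+ k.+1]exprS [wgt p ^+ k.+2]exprS w0 !(mul0r, mulr0, addr0, add0r).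
set W := 0 ^+ k.
rewrite (_ : _ + _ = - (2 * k.+1%:R) * W * phi (L p) * (p.1 ^+ 2 + p.2 ^+ 2)); last by ring.
by rewrite h; ring.
Qed.

(** The derivative of exp(-2x) phi is exp(-2x) chi. Keeping exp(-2x) apart lets the weight absorb
    it, so that only [phi] and [chi] need a growth bound with exponent above -2. *)
Let chi x := psi x - 2 * phi x.

Let cchi : continuous chi.
Proof.
move=> x; apply: cvgB; first exact: cpsi.
by apply: cvgM; [exact: cvg_cst|exact: cphi].
Qed.

Let chib x : x <= 1 -> `|chi x| <= 3 * C * expR (al * x).
Proof.
move=> x1; apply: (le_trans (ler_normB _ _)); rewrite normrM ger0_norm//.
by have := phib x x1; have := psib x x1; lra.
Qed.

Let phib3 x : x <= 1 -> `|phi x| <= 3 * C * expR (al * x).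
Proof.
move=> x1; apply: (le_trans (phib x x1)); apply: ler_wpM2r; first exact: expR_ge0.
by move: C0; lra.
Qed.

Let phi2 x := expR (- 2 * x) * phi x.
Let psi2 x := expR (- 2 * x) * chi x.

Let hphi2 (x : R) : is_derive x 1 phi2 (psi2 x).
Proof.
have h1 : is_derive x 1 (fun x : R => - 2 * x) (- 2).
  by apply: is_derive_eq; rewrite /GRing.scale/=; ring.
have h2 := @is_derive1_comp R (@expR R) (fun x => - 2 * x) x _ _ (is_derive_expR _) h1.
have h3 := @is_deriveM R R^o _ _ x 1 _ _ h2 (hphi x).
by apply: (is_derive_eq h3); rewrite /GRing.scale/= /psi2 /chi; ring.
Qed.

Let cpsi2 : continuous psi2.
Proof.
move=> x; apply: cvgM; last exact: cchi.
apply: (@continuous_comp _ _ _ (fun x : R => - 2 * x) (@expR R)); last exact: continuous_expR.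
by apply: cvgM; [exact: cvg_cst|exact: cvg_id].
Qed.

Lemma integrable_slice_x2 k :
  int (fun p : TT => slice_deriv phi2 psi2 k.+1 (1 - p.2 ^+ 2) 1 (p.2 ^+ 2) 1 p.1).
Proof.
rewrite (_ : (fun p => _) = (fun p : TT =>
  (k.+2%:R * (wgt p ^+ k.+1 * expR (- 2 * L p)) * (- 2 * p.1) * (p.1 + 1)
    + wgt p ^+ k.+2 * expR (- 2 * L p)) * phi (L p) +
  wgt p ^+ k.+2 * expR (- 2 * L p) * ((p.1 + 1) * (p.1 + 1) / nrm1 p) * chi (L p))); last first.
  apply/funext => p; rewrite slice_x /phi2 /psi2; set X := (nrm1 p)^-1.
  by rewrite [wgt p ^+ k.+2]exprS; ring.
apply: (integrable_comb phi chi _ _ (3 * C) (2 * k.+2%:R * 2 + 4)) => //; try by meas.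
- exact: mulr_ge0.
- move=> p Dp p2; have [u1 _] := disk_coord p Dp.
  have /andP[a0 a1] := wgtX_le1 k p Dp; have /andP[b0 b1] := wgt_Einv_le k p Dp p2.
  have [t1 _] := wgt_ratio p _ Dp p2 (coord_le_nrm1 p).1.
  apply: (le_trans (ler_normD _ _)).
  rewrite (ger0_norm b0); apply: lerD => //.
  apply: norm_term_le => //; rewrite expRN2_log ?nrm1_gt0//.
  rewrite (_ : _ * (p.1 + 1) = wgt p ^+ k * p.1 * (wgt p * (p.1 + 1) / nrm1 p)); last first.
    by rewrite exprS; set X := (nrm1 p)^-1; ring.
  rewrite normrM -[2]mul1r; apply: ler_pM => //.
  by rewrite normrM (ger0_norm a0) -[1]mul1r; exact: ler_pM.
- move=> p Dp p2; have q0 := nrm1_gt0 p p2.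
  have /andP[b0 b1] := wgt_Einv_le k p Dp p2.
  have [_ t1] := wgt_ratio p _ Dp p2 (coord_le_nrm1 p).1.
  have t0 : 0 <= (p.1 + 1) ^+ 2 / nrm1 p by rewrite divr_ge0 ?sqr_ge0 ?(ltW q0).
  rewrite -expr2 ger0_norm; last exact: mulr_ge0.
  apply: (@le_trans _ _ (4 * 1)); first exact: ler_pM.
  have : 0 <= k.+2%:R :> R by [].
  lra.
Qed.

Lemma integrable_slice_y2 k :
  int (fun p : TT => slice_deriv phi2 psi2 k.+1 (1 - p.1 ^+ 2) 0 ((p.1 + 1) ^+ 2) 0 p.2).
Proof.
rewrite (_ : (fun p => _) = (fun p : TT =>
  (k.+2%:R * (wgt p ^+ k.+1 * expR (- 2 * L p)) * (- 2 * p.2) * p.2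
    + wgt p ^+ k.+2 * expR (- 2 * L p)) * phi (L p) +
  wgt p ^+ k.+2 * expR (- 2 * L p) * (p.2 * p.2 / nrm1 p) * chi (L p))); last first.
  apply/funext => p; rewrite slice_y /phi2 /psi2; set X := (nrm1 p)^-1.
  by rewrite [wgt p ^+ k.+2]exprS; ring.
apply: (integrable_comb phi chi _ _ (3 * C) (2 * k.+2%:R * 2 + 4)) => //; try by meas.
- exact: mulr_ge0.
- move=> p Dp p2; have [_ u1] := disk_coord p Dp.
  have /andP[a0 a1] := wgtX_le1 k p Dp; have /andP[b0 b1] := wgt_Einv_le k p Dp p2.
  have [t1 _] := wgt_ratio p _ Dp p2 (coord_le_nrm1 p).2.
  apply: (le_trans (ler_normD _ _)).
  rewrite (ger0_norm b0); apply: lerD => //.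
  apply: norm_term_le => //; rewrite expRN2_log ?nrm1_gt0//.
  rewrite (_ : _ * p.2 = wgt p ^+ k * p.2 * (wgt p * p.2 / nrm1 p)); last first.
    by rewrite exprS; set X := (nrm1 p)^-1; ring.
  rewrite normrM -[2]mul1r; apply: ler_pM => //.
  by rewrite normrM (ger0_norm a0) -[1]mul1r; exact: ler_pM.
- move=> p Dp p2; have q0 := nrm1_gt0 p p2.
  have /andP[b0 b1] := wgt_Einv_le k p Dp p2.
  have [_ t1] := wgt_ratio p _ Dp p2 (coord_le_nrm1 p).2.
  have t0 : 0 <= p.2 ^+ 2 / nrm1 p by rewrite divr_ge0 ?sqr_ge0 ?(ltW q0).
  rewrite -expr2 ger0_norm; last exact: mulr_ge0.
  apply: (@le_trans _ _ (4 * 1)); first exact: ler_pM.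
  have : 0 <= k.+2%:R :> R by [].
  lra.
Qed.

(* Integral of the divergence of w^(k+2) |1+x|^-2 phi(log |1+x|) (1+x). *)
Lemma recurrence2 k :
  k.+2%:R * I (fun p => wgt p ^+ k.+1 * phi (L p)) =
  k.+2%:R * I (fun p => wgt p ^+ k.+2 * expR (- 2 * L p) * phi (L p))
  + I (fun p => wgt p ^+ k.+2 * expR (- 2 * L p) * psi (L p)).
Proof.
have mD : measurable (D : set TT) by exact: measurable_disk.
have ix := integrable_slice_x2 k; have iy := integrable_slice_y2 k.
have ex : I (fun p => slice_deriv phi2 psi2 k.+1 (1 - p.2 ^+ 2) 1 (p.2 ^+ 2) 1 p.1) = 0.
  by rewrite /Rintegral (divergence_x_eq0 _ _ hphi2 cpsi2).
have ey : I (fun p => slice_deriv phi2 psi2 k.+1 (1 - p.1 ^+ 2) 0 ((p.1 + 1) ^+ 2) 0 p.2) = 0.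
  by rewrite /Rintegral (divergence_y_eq0 _ _ hphi2 cpsi2).
have e0 := RintegralD mD ix iy; rewrite ex ey addr0 in e0.
have i1 := integrable_wgt phi psi al C hphi al2 al0 C0 phib k.+1.
have i2 := integrable_wgt_Einv phi psi al C hphi al2 al0 C0 phib k.
have i3 : int (fun p => wgt p ^+ k.+2 * expR (- 2 * L p) * psi (L p)).
  apply: (integrable_log al C 4) => //; first by meas.
  by move=> p Dp p2; have /andP[h1 h2] := wgt_Einv_le k p Dp p2; rewrite ger0_norm.
(* Away from x = -1, (1+x)/|1+x|^2 is divergence free and is the gradient of log |1+x|, so only the
   derivatives of w^(k+2) and of phi contribute; again x . (1+x) = (|1+x|^2 - w)/2. The fourth
   summand is padding. *)
have := Rintegral_lin4 (- k.+2%:R) k.+2%:R 1 0 _ _ _ _ i1 i2 i3 i3.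
rewrite -(_ : 0 = I _); first by move=> h; lra.
rewrite -[LHS]e0; apply: eq_Rintegral => p; rewrite inE => Dp /=.
rewrite slice_x slice_y /phi2 /psi2 /chi.
have [q0|q0] := ltP 0 (nrm1 p).
  rewrite expRN2_log// [wgt p ^+ k.+2]exprS; move: q0; set W := wgt p ^+ k.+1.
  set F := phi _; set G := psi _; rewrite /wgt /nrm1 => q0.
  by field; rewrite gt_eqF.
have w0 : wgt p = 0.
  have h := wgt_sq_le p Dp; apply/eqP; rewrite -sqrf_eq0 eq_le sqr_ge0 andbT; lra.
by rewrite !(exprS (wgt p)) w0; ring.
Qed.

End Recurrence.

(** * Concentration of the weighted measures at the origin *)

Section Concentration.
Context {R : realType}.
Local Notation A := (@areaR R).
Local Notation D := (@diskR R).
Local Notation TT := (measurableTypeR R * measurableTypeR R)%type.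
Local Notation L := (@log_abs_xp1 R).
Local Notation I f := (Rintegral A D f).
Local Notation int f := (A.-integrable D (EFin \o (f : TT -> R))).

(** For phi = 1 and psi = 0, [recurrence1] says that (k+1) times the integral of w^k does not depend
    on [k]; at k = 0 it is the area. *)
Lemma integral_wgtX k : k.+1%:R * I (fun p => wgt p ^+ k) = pi.
Proof.
elim: k => [|k IH].
  under eq_Rintegral do rewrite expr0.
  have mD : measurable (D : set TT) by exact: measurable_disk.
  rewrite mul1r; transitivity (1 * fine (A D)); last by rewrite area_disk mul1r.
  exact: Rintegral_cst.
have h1 (x : R) : is_derive x 1 (fun=> 1 : R) (0 : R) by exact: is_derive_cst.
have c0 : continuous (fun _ : R => 0 : R) by move=> x; exact: cvg_cst.
have b1 (x : R) : x <= 1 -> `|1 : R| <= 1 * expR (0 * x) by move=> _; rewrite mul0r expR0 normr1 mul1r.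
have b0 (x : R) : x <= 1 -> `|0 : R| <= 1 * expR (0 * x) by move=> _; rewrite mul0r expR0 normr0 mul1r.
have l20 : -2 < 0 :> R by lra.
have r1 := recurrence1 (fun=> 1) (fun=> 0) 0 1 h1 c0 l20 (lexx _) ler01 b1 b0 k.
have r2 := recurrence2 (fun=> 1) (fun=> 0) 0 1 h1 c0 l20 (lexx _) ler01 b1 b0 k.
have e1 n : I (fun p => wgt p ^+ n * 1) = I (fun p => wgt p ^+ n).
  by apply: eq_Rintegral => p _; rewrite mulr1.
have e0 (h : R * R -> R) : I (fun p => h p * 0) = 0.
  under eq_Rintegral do rewrite mulr0.
  by rewrite /Rintegral integral0.
rewrite !e1 !e0 in r1; rewrite -IH -natr1 mulrDl.
move: r1; rewrite -natr1; lra.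
Qed.

Lemma disk_integrable_wgtM (f : TT -> R) k : int f -> int (fun p => wgt p ^+ k * f p).
Proof.
move=> fi; have mD : measurable (D : set TT) by exact: measurable_disk.
have fi' := fi; apply: le_integrable fi' => //.
  apply: (@measurable_EFin _ _ TT); apply: measurable_funM.
    by apply: measurable_funTS; exact: measurable_wgtX.
  by have := measurable_int _ fi => /(@measurable_EFinP _ TT R D f).
move=> p Dp; rewrite /= lee_fin normrM; have /andP[h1 h2] := wgtX_le1 k p Dp.
by rewrite (ger0_norm h1) ler_piMl.
Qed.

(** With r = sqrt q < 1, (k+1) r^k is at most the geometric sum 1 + r + ... + r^k, so (k+1) q^k <=
    r^k/(1 - r). *)
Lemma cvg_natM_expr (q : R) : 0 <= q < 1 -> (fun k => k.+1%:R * q ^+ k) @ \oo --> (0 : R).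
Proof.
move=> /andP[q0 q1]; pose r := Num.sqrt q.
have r0 : 0 <= r by exact: sqrtr_ge0.
have rq : q = r * r by rewrite -expr2 sqr_sqrtr.
have r1 : r < 1 by rewrite -sqrtr1 ltr_sqrt.
apply: (@squeeze_cvgr _ _ _ _ (fun=> 0) (fun k => (1 - r)^-1 * r ^+ k)); last 2 first.
- exact: cvg_cst.
- rewrite -[0](mulr0 (1 - r)^-1); apply: cvgMr; apply: cvg_expr; by rewrite ger0_norm.
apply: nearW => k; rewrite mulr_ge0 ?exprn_ge0//= rq exprMn mulrA.
apply: ler_wpM2r; first exact: exprn_ge0.
apply: le_trans (geometric_sum_le R r k.+1 _); last by rewrite r0.
rewrite mulr_natl -[X in _ *+ X]card_ord -sumr_const; apply: ler_sum => i _.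
by apply: ler_wiXn2l; rewrite ?(ltW r1)// -ltnS.
Qed.

(** Where |x|^2 < d, continuity at the origin makes the error at most e/2. Elsewhere w <= 1 - d, and
    (k+1)(1-d)^k times the L1 norm of f - f(0,0) tends to 0; so f may be unbounded near x = -1. *)
Lemma concentration (f : TT -> R) : int f ->
  (forall e, 0 < e -> exists2 d, 0 < d & forall p : R * R, p.1 ^+ 2 + p.2 ^+ 2 < d -> `|f p - f (0, 0)| <= e) ->
  (fun k => k.+1%:R / pi * I (fun p => wgt p ^+ k * f p)) @ \oo --> f (0, 0).
Proof.
move=> fi cf; set c := f (0, 0).
have mD : measurable (D : set TT) by exact: measurable_disk.
have pi0 := @pi_gt0 R.
have one_int : int (fun=> 1).
  have l20 : -2 < 0 :> R by lra.
  by apply: (@integrable_disk R 0 1) => // p _ _; rewrite mul0r powRr0 mulr1 normr1.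
have wint k : int (fun p => wgt p ^+ k).
  by have := disk_integrable_wgtM _ k one_int; under eq_fun do rewrite mulr1.
have gi : int (fun p => f p - c).
  by have := disk_integrableD _ _ fi (disk_integrableZ (- c) _ one_int); under [X in EFin \o X]eq_fun do rewrite mulr1.
have gn : int (fun p => `|f p - c|) by exact: integrable_norm.
set K := I (fun p => `|f p - c|).
have K0 : 0 <= K by apply: Rintegral_ge0.
apply/cvgrPdistC_le => e e0.
have e20 : 0 < e / 2 by lra.
have [d0 d00 hd] := cf _ e20.
(* The cap 1/2 keeps 1 - d in [0, 1), as the geometric decay requires. *)
pose d := Num.min d0 (1 / 2).
have dpos : 0 < d by rewrite lt_min d00; lra.
have d12 : d <= 1 / 2 by rewrite ge_min lexx orbT.
have B0 : (fun k => K / pi * (k.+1%:R * (1 - d) ^+ k)) @ \oo --> (0 : R).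
  rewrite -[0](mulr0 (K / pi)); apply: cvgMr; apply: cvg_natM_expr.
  by apply/andP; split; lra.
near=> k.
have kp : 0 <= k.+1%:R / pi :> R by rewrite divr_ge0// ltW.
have -> : k.+1%:R / pi * I (fun p => wgt p ^+ k * f p) - c =
   k.+1%:R / pi * I (fun p => wgt p ^+ k * (f p - c)).
  have -> : I (fun p => wgt p ^+ k * (f p - c)) =
      I (fun p => wgt p ^+ k * f p) + (- c) * I (fun p => wgt p ^+ k).
    rewrite -(RintegralZl _ mD (wint k)) -(RintegralD mD (disk_integrable_wgtM _ k fi) (disk_integrableZ _ _ (wint k))).
    by apply: eq_Rintegral => p _; ring.
  have := integral_wgtX k; set X := I (fun p => wgt p ^+ k) => mX.
  rewrite mulrDr; congr (_ + _).
  rewrite (_ : _ * (- c * X) = - c * (k.+1%:R * X) / pi); last by ring.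
  by rewrite mX mulfK// gt_eqF.
rewrite normrM (ger0_norm kp).
have i1 := disk_integrable_wgtM _ k gi.
have i2 : int (fun p => (e / 2) * wgt p ^+ k + (1 - d) ^+ k * `|f p - c|).
  by apply: disk_integrableD; apply: disk_integrableZ.
have step : `|I (fun p => wgt p ^+ k * (f p - c))| <= e / 2 * I (fun p => wgt p ^+ k) + (1 - d) ^+ k * K.
  apply: (le_trans (le_normr_Rintegral mD i1)).
  apply: (@le_trans _ _ (I (fun p => (e / 2) * wgt p ^+ k + (1 - d) ^+ k * `|f p - c|))).
    apply: le_Rintegral => //; first exact: (integrable_norm i1).
    move=> p Dp; have /andP[w0 w1] := wgtX_le1 k p Dp.
    rewrite normrM (ger0_norm w0).
    have [pd|dp] := ltP (p.1 ^+ 2 + p.2 ^+ 2) d.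
      have /hd h : p.1 ^+ 2 + p.2 ^+ 2 < d0 by apply: (lt_le_trans pd); rewrite ge_min lexx.
      rewrite -[X in X <= _]addr0 mulrC; apply: lerD; first exact: ler_wpM2r.
      by rewrite mulr_ge0// exprn_ge0//; lra.
    rewrite -[X in X <= _]add0r; apply: lerD; first by rewrite mulr_ge0//; lra.
    apply: ler_wpM2r => //; apply: lerXn2r; rewrite ?nnegrE; last 2 first.
    - by lra.
    - by rewrite /wgt; lra.
    - by have /andP[] := wgt01 p Dp.
  rewrite (RintegralD mD (disk_integrableZ _ _ (wint k)) (disk_integrableZ _ _ gn)).
  by rewrite (RintegralZl _ mD (wint k)) (RintegralZl _ mD gn).
apply: (le_trans (ler_wpM2l kp step)).
have := integral_wgtX k; set X := I (fun p => wgt p ^+ k) => mX.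
rewrite (_ : k.+1%:R / pi * _ = e / 2 * (k.+1%:R * X) / pi + K / pi * (k.+1%:R * (1 - d) ^+ k)); last by ring.
rewrite mX mulfK ?gt_eqF//.
have : K / pi * (k.+1%:R * (1 - d) ^+ k) <= e / 2 by near: k; exact: (cvgr_le 0 B0).
lra.
Unshelve. all: by end_near. Qed.

Lemma log_abs_xp1_origin : L (0, 0) = 0.
Proof. by rewrite /log_abs_xp1/= add0r expr1n expr0n/= addr0 sqrtr1 ln1. Qed.

Lemma log_comp_continuous_origin (phi : R -> R) : continuous phi ->
  forall e, 0 < e -> exists2 d, 0 < d &
    forall p : R * R, p.1 ^+ 2 + p.2 ^+ 2 < d -> `|phi (L p) - phi (L (0, 0))| <= e.
Proof.
move=> cphi e e0.
pose G (q : R) := phi (ln (Num.sqrt q)).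
have cG : {for 1, continuous G}.
  apply: (@continuous_comp _ _ _ (fun q : R => ln (Num.sqrt q)) phi); last exact: cphi.
  apply: (@continuous_comp _ _ _ (@Num.sqrt R) (@ln R)); first exact: sqrt_continuous.
  by apply: continuous_ln; rewrite sqrtr1.
have /cvgrPdistC_le/(_ e e0) /nbhs_ballP[eta /= eta0 heta] : G x @[x --> (1 : R)] --> G (1 : R) by exact: cG.
(* If |x| < m <= 1, then |1+x|^2 differs from 1 by |2u + |x|^2| < 2m + m^2 <= 3m < eta. *)
pose m := Num.min 1 (eta / 4).
have m0 : 0 < m by rewrite lt_min ltr01 divr_gt0.
have m1 : m <= 1 by rewrite ge_min lexx.
have m4 : m <= eta / 4 by rewrite ge_min lexx orbT.
exists (m ^+ 2); first exact: exprn_gt0.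
move=> p hp; rewrite /log_abs_xp1 /= add0r expr1n expr0n/= addr0.
apply: (heta ((p.1 + 1) ^+ 2 + p.2 ^+ 2)); rewrite /ball/=.
have y0 := sqr_ge0 p.2; have x0 := sqr_ge0 p.1.
have : `|p.1| < m.
  rewrite -(@ltr_pXn2r _ 2)// ?nnegrE ?(ltW m0)// real_normK ?num_real//; lra.
rewrite ltr_norml => /andP[a1 a2].
rewrite (_ : 1 - _ = - (2 * p.1 + (p.1 ^+ 2 + p.2 ^+ 2))); last by ring.
rewrite normrN ltr_norml; apply/andP; split; nra.
Qed.

End Concentration.

(** * Complex moments and the conclusion *)

Section Moments.
Context {R : realType}.
Local Notation A := (@areaR R).
Local Notation D := (@diskR R).
Local Notation TT := (measurableTypeR R * measurableTypeR R)%type.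
Local Notation L := (@log_abs_xp1 R).
Local Notation I f := (Rintegral A D f).
Local Notation int f := (A.-integrable D (EFin \o (f : TT -> R))).
Local Notation C := (complex.complex R).
Local Notation "x %:C" := (complex.real_complex_def (Phant R) x) (at level 2, format "x %:C").

Variables (a b : R).
Hypothesis hs : a ^+ 2 + b ^+ 2 < 4.
Local Notation s := (complex.Complex a b).

(** Real part of exp(s x), with [pi_] its imaginary part; [dpr] and [dpi] are those of s exp(s
    x). *)
Let pr x := expR (a * x) * cos (b * x).
Let pi_ x := expR (a * x) * sin (b * x).
Let dpr x := a * pr x - b * pi_ x.
Let dpi x := b * pr x + a * pi_ x.

Let is_derive_pr (x : R) : is_derive x 1 pr (dpr x).
Proof.
have h1 : is_derive x 1 (fun x : R => a * x) a.
  by apply: is_derive_eq; rewrite /GRing.scale/=; ring.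
have h2 : is_derive x 1 (fun x : R => b * x) b.
  by apply: is_derive_eq; rewrite /GRing.scale/=; ring.
have h3 := @is_derive1_comp R (@expR R) (fun x => a * x) x _ _ (is_derive_expR _) h1.
have h4 := @is_derive1_comp R (@cos R) (fun x => b * x) x _ _ (is_derive_cos _) h2.
have h5 := @is_deriveM R R^o _ _ x 1 _ _ h3 h4.
by apply: (is_derive_eq h5); rewrite /GRing.scale/= /dpr /pr /pi_; ring.
Qed.

Let is_derive_pi (x : R) : is_derive x 1 pi_ (dpi x).
Proof.
have h1 : is_derive x 1 (fun x : R => a * x) a.
  by apply: is_derive_eq; rewrite /GRing.scale/=; ring.
have h2 : is_derive x 1 (fun x : R => b * x) b.
  by apply: is_derive_eq; rewrite /GRing.scale/=; ring.
have h3 := @is_derive1_comp R (@expR R) (fun x => a * x) x _ _ (is_derive_expR _) h1.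
have h4 := @is_derive1_comp R (@sin R) (fun x => b * x) x _ _ (is_derive_sin _) h2.
have h5 := @is_deriveM R R^o _ _ x 1 _ _ h3 h4.
by apply: (is_derive_eq h5); rewrite /GRing.scale/= /dpi /pr /pi_; ring.
Qed.

Let cpr : continuous pr.
Proof. by move=> x; exact: is_derive_continuous (is_derive_pr x). Qed.

Let cpi : continuous pi_.
Proof. by move=> x; exact: is_derive_continuous (is_derive_pi x). Qed.

Let cdpr : continuous dpr.
Proof.
move=> x; apply: cvgB; apply: cvgM; try exact: cvg_cst; [exact: cpr|exact: cpi].
Qed.

Let cdpi : continuous dpi.
Proof.
move=> x; apply: cvgD; apply: cvgM; try exact: cvg_cst; [exact: cpr|exact: cpi].
Qed.

(** The integrability bound takes an exponent in (-2, 0], but [a] may be positive. As al <= a, exp(a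
    x) <= exp(a - al) exp(al x) for x <= 1. The factor in [K'] makes one constant serve the
    functions and their derivatives. *)
Let al := Num.min a (- 1).
Let K := expR (a - al).
Let K' := (1 + `|a| + `|b|) * K.

Let al2 : -2 < al.
Proof.
rewrite lt_min; apply/andP; split; last by lra.
rewrite ltNge; apply/negP => a2; have b0 := sqr_ge0 b; move: hs b0.
have : 4 <= a ^+ 2 by nra.
by lra.
Qed.

Let al0 : al <= 0.
Proof. by rewrite ge_min; apply/orP; right; lra. Qed.

Let expb x : x <= 1 -> expR (a * x) <= K * expR (al * x).
Proof.
move=> x1; rewrite -expRD ler_expR.
have : 0 <= a - al by rewrite subr_ge0 ge_min lexx.
nra.
Qed.

Let K0 : 0 <= K. Proof. exact: expR_ge0. Qed.
Let K'0 : 0 <= K'. Proof. by rewrite mulr_ge0// !addr_ge0. Qed.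

Let KK' x : K * expR (al * x) <= K' * expR (al * x).
Proof.
apply: ler_wpM2r; first exact: expR_ge0.
by rewrite /K' -[X in X <= _]mul1r; apply: ler_wpM2r => //; rewrite -addrA lerDl addr_ge0.
Qed.

Let trig_le (x y : R) : `|y| <= 1 -> x <= 1 -> `|expR (a * x) * y| <= K * expR (al * x).
Proof.
move=> y1 x1; rewrite normrM ger0_norm ?expR_ge0//; apply: le_trans (expb x x1).
by rewrite ler_piMr// expR_ge0.
Qed.

Let prb0 x : x <= 1 -> `|pr x| <= K * expR (al * x).
Proof. by apply: trig_le; rewrite ler_norml cos_geN1 cos_le1. Qed.

Let pib0 x : x <= 1 -> `|pi_ x| <= K * expR (al * x).
Proof. by apply: trig_le; rewrite ler_norml sin_geN1 sin_le1. Qed.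

Let prb x : x <= 1 -> `|pr x| <= K' * expR (al * x).
Proof. by move=> x1; exact: le_trans (prb0 x x1) (KK' x). Qed.

Let pib x : x <= 1 -> `|pi_ x| <= K' * expR (al * x).
Proof. by move=> x1; exact: le_trans (pib0 x x1) (KK' x). Qed.

Let comb_le (u v y z B : R) : `|y| <= B -> `|z| <= B -> `|u * y + v * z| <= (1 + `|u| + `|v|) * B.
Proof.
move=> yB zB; apply: (le_trans (ler_normD _ _)); rewrite !normrM.
have B0 : 0 <= B by exact: le_trans (normr_ge0 y) yB.
have := ler_wpM2l (normr_ge0 u) yB; have := ler_wpM2l (normr_ge0 v) zB; nra.
Qed.

Let dprb x : x <= 1 -> `|dpr x| <= K' * expR (al * x).
Proof.
move=> x1; rewrite /dpr -mulNr /K' -mulrA -(normrN b).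
by apply: comb_le; [exact: prb0|exact: pib0].
Qed.

Let dpib x : x <= 1 -> `|dpi x| <= K' * expR (al * x).
Proof.
move=> x1; rewrite /dpi addrC /K' -mulrA.
by apply: comb_le; [exact: pib0|exact: prb0].
Qed.

Let mD : measurable (D : set TT). Proof. exact: measurable_disk. Qed.

(** The integral of w^k |1+x|^s; [N k] is that of w^(k+2) |1+x|^(s-2), the quantity to be
    eliminated. *)
Let M k : C := complex.Complex (I (fun p => wgt p ^+ k * pr (L p))) (I (fun p => wgt p ^+ k * pi_ (L p))).
Let N k : C := complex.Complex
  (I (fun p => wgt p ^+ k.+2 * expR (- 2 * L p) * pr (L p)))
  (I (fun p => wgt p ^+ k.+2 * expR (- 2 * L p) * pi_ (L p))).

Let Rintegral_comb (h : TT -> R) (u v : R) (f : R -> R) :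
  int (fun p => h p * pr (L p)) -> int (fun p => h p * pi_ (L p)) ->
  (forall x, f x = u * pr x + v * pi_ x) ->
  I (fun p => h p * f (L p)) = u * I (fun p => h p * pr (L p)) + v * I (fun p => h p * pi_ (L p)).
Proof.
move=> i1 i2 fE.
rewrite -(RintegralZl _ mD i1) -(RintegralZl _ mD i2) -(RintegralD mD (disk_integrableZ _ _ i1) (disk_integrableZ _ _ i2)).
by apply: eq_Rintegral => p _; rewrite fE; ring.
Qed.

Let ir k := integrable_wgt pr dpr al K' is_derive_pr al2 al0 K'0 prb k.
Let ii k := integrable_wgt pi_ dpi al K' is_derive_pi al2 al0 K'0 pib k.
Let jr k := integrable_wgt_Einv pr dpr al K' is_derive_pr al2 al0 K'0 prb k.
Let ji k := integrable_wgt_Einv pi_ dpi al K' is_derive_pi al2 al0 K'0 pib k.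

Let dprE x : dpr x = a * pr x + (- b) * pi_ x. Proof. by rewrite /dpr mulNr. Qed.

(** For phi = exp(s x) one has psi = s phi, so the real recurrences for [pr] and [pi_] combine into
    one complex equation. *)
Lemma moment_rec1 k :
  2 * k.+1%:R%:C * M k = (2 * k.+1%:R%:C + 2) * M k.+1 + (2^-1)%:C * (s * M k.+1) - (2^-1)%:C * (s * N k).
Proof.
have r1 := recurrence1 pr dpr al K' is_derive_pr cdpr al2 al0 K'0 prb dprb k.
have r2 := recurrence1 pi_ dpi al K' is_derive_pi cdpi al2 al0 K'0 pib dpib k.
rewrite (Rintegral_comb _ _ _ dpr (ir k.+1) (ii k.+1) dprE) (Rintegral_comb _ _ _ dpr (jr k) (ji k) dprE) in r1.
rewrite (Rintegral_comb _ _ _ dpi (ir k.+1) (ii k.+1) (fun=> erefl)) (Rintegral_comb _ _ _ dpi (jr k) (ji k) (fun=> erefl)) in r2.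
have -> : 2 = 2%:C :> C by rewrite -[2%:C]/(1 + 1)%:C rcD rc1.
rewrite -!rcM -rcD; apply: complexP; rewrite ?Re_addc ?Im_addc.
- rewrite Re_mulc (_ : complex.Re (- _) = - complex.Re ((2^-1)%:C * (s * N k))) //.
  rewrite !(Re_mulc, Im_mulc) /= ?(Re_mulc, Im_mulc) /=; move: r1; lra.
- rewrite Im_mulc (_ : complex.Im (- _) = - complex.Im ((2^-1)%:C * (s * N k))) //.
  rewrite !(Re_mulc, Im_mulc) /= ?(Re_mulc, Im_mulc) /=; move: r2; lra.
Qed.

Lemma moment_rec2 k : k.+2%:R%:C * M k.+1 = k.+2%:R%:C * N k + s * N k.
Proof.
have r1 := recurrence2 pr dpr al K' is_derive_pr cdpr al2 al0 K'0 prb dprb k.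
have r2 := recurrence2 pi_ dpi al K' is_derive_pi cdpi al2 al0 K'0 pib dpib k.
rewrite (Rintegral_comb _ _ _ dpr (jr k) (ji k) dprE) in r1.
rewrite (Rintegral_comb _ _ _ dpi (jr k) (ji k) (fun=> erefl)) in r2.
apply: complexP; rewrite ?Re_addc ?Im_addc ?Re_mulc ?Im_mulc /=.
- by rewrite !mul0r !subr0 r1; ring.
- by rewrite !mul0r !addr0 r2; ring.
Qed.

Let J n : C := ((n.+1%:R / pi)%:C) * M n.

(* Eliminating N k between the two moment recurrences. *)
Lemma moment_ratio k :
  (1 + (k.+2%:R^-1)%:C * s) * J k = (1 + (k.+2%:R^-1)%:C * (2^-1%:C * s)) ^+ 2 * J k.+1.
Proof.
have e1 := moment_rec1 k; have e2 := moment_rec2 k.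
rewrite /J; set X := M k in e1 *; set Y := M k.+1 in e1 e2 *; set Z := N k in e1 e2.
rewrite [(k.+1%:R / pi)%:C]rcM [(k.+2%:R / pi)%:C]rcM; set P := (pi^-1)%:C.
set c := (k.+2%:R^-1)%:C; set t := 2^-1%:C * s.
have two : 2 = 2%:C :> C by rewrite -[2%:C]/(1 + 1)%:C rcD rc1.
have st : s = 2 * t by rewrite /t mulrA two -rcM mulfV// rc1 mul1r.
have cn : c * k.+2%:R%:C = 1 by rewrite /c -rcM mulVf ?rc1// pnatr_eq0.
have kn : k.+2%:R%:C = k.+1%:R%:C + 1 by rewrite -[k.+2]addn1 natrD rcD.
have h2 (x y : C) : 2 * x = 2 * y -> x = y.
  by move=> /(congr1 ( *%R (2^-1)%:C)); rewrite !mulrA two -rcM mulVf// rc1 !mul1r.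
have YZ : Y = (1 + c * s) * Z.
  by rewrite -[LHS]mul1r -cn -mulrA e2 mulrDr !mulrA cn mul1r mulrDl mul1r.
rewrite [(2^-1)%:C * (s * Y)]mulrA [(2^-1)%:C * (s * Z)]mulrA -/t in e1.
apply: h2.
(* Multiplying the first recurrence by 1 + c s makes (1 + c s) Z appear, which [YZ] turns into Y
   without any division. *)
have -> : 2 * ((1 + c * s) * (k.+1%:R%:C * P * X)) = P * ((1 + c * s) * (2 * k.+1%:R%:C * X)) by ring.
rewrite e1.
have -> : (1 + c * s) * ((2 * k.+1%:R%:C + 2) * Y + t * Y - t * Z) =
   (1 + c * s) * (2 * k.+2%:R%:C + t) * Y - t * ((1 + c * s) * Z) by rewrite kn; ring.
rewrite -YZ st.
have -> : (1 + c * (2 * t)) * (2 * k.+2%:R%:C + t) * Y - t * Y =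
   2 * (k.+2%:R%:C + 2 * (c * k.+2%:R%:C) * t + c * t ^+ 2) * Y by ring.
rewrite (_ : 2 * ((1 + c * t) ^+ 2 * (k.+2%:R%:C * P * Y)) =
  P * (2 * (k.+2%:R%:C + 2 * (c * k.+2%:R%:C) * t + c * (c * k.+2%:R%:C) * t ^+ 2) * Y)); last by ring.
by rewrite cn !mulr1.
Qed.

Lemma moment_cvg : ccvg R J 1.
Proof.
have i0 (f : R -> R) : int (fun p => wgt p ^+ 0 * f (L p)) -> int (f \o L).
  by under [X in EFin \o X]eq_fun do rewrite expr0 mul1r.
split.
  have := concentration (pr \o L) (i0 _ (ir 0%N)) (log_comp_continuous_origin _ cpr).
  rewrite /= log_abs_xp1_origin /pr !mulr0 expR0 cos0 mulr1.
  by rewrite (_ : (fun _ => _) = (@complex.Re R) \o J)//; apply/funext => k; rewrite /J /= ?Re_mulc /= mul0r subr0.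
have := concentration (pi_ \o L) (i0 _ (ii 0%N)) (log_comp_continuous_origin _ cpi).
rewrite /= log_abs_xp1_origin /pi_ !mulr0 expR0 sin0 mulr0.
by rewrite (_ : (fun _ => _) = (@complex.Im R) \o J)//; apply/funext => k; rewrite /J /= ?Im_mulc /= mul0r addr0.
Qed.

Lemma areal_zeta_mahler :
  int (pow_re a b) /\ int (pow_im a b) /\
  complex.Complex (pi^-1 * I (pow_re a b)) (pi^-1 * I (pow_im a b)) =
  cexp R (complex.Complex (S_re s) (S_im s)).
Proof.
have er : (fun p => wgt p ^+ 0 * pr (L p)) = pow_re a b.
  by apply/funext => p; rewrite expr0 mul1r.
have ei : (fun p => wgt p ^+ 0 * pi_ (L p)) = pow_im a b.
  by apply/funext => p; rewrite expr0 mul1r.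
split; first by rewrite -er; exact: (ir 0%N).
split; first by rewrite -ei; exact: (ii 0%N).
have s2 : complex.ComplexField.Normc.normc s < 2.
  have -> : 2 = Num.sqrt 4 :> R.
    by rewrite (_ : 4 = 2 ^+ 2); [rewrite sqrtr_sqr ger0_norm|ring].
  by rewrite /= ltr_sqrt.
(* The product starts at n = 2 and the moments at index 0, hence the shift by 2: factor n = k + 2
   links J k and J (k+1). *)
rewrite -(infinite_product R s (fun n => J (n - 2)) s2).
- rewrite /J subnn /M er ei mul1r; apply: complexP; rewrite ?Re_mulc ?Im_mulc /= mul0r ?subr0 ?addr0//.
- by move=> [|[|k]]// _; rewrite !subSS !subn0; exact: moment_ratio.
- have [h1 h2] := moment_cvg.
  split; rewrite -(cvg_shiftn 2) /=.
    by rewrite (_ : (fun _ => _) = (@complex.Re R) \o J)//; apply/funext => n /=; rewrite addnK.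
  by rewrite (_ : (fun _ => _) = (@complex.Im R) \o J)//; apply/funext => n /=; rewrite addnK.
Qed.

End Moments.

(* s = a + i b with |s| < 2.  The identity of complex numbers
   (1/pi) * int_D |x+1|^s dA(x) = exp (sum_{j>=2} coef j * s^j)
   is stated through its real and imaginary parts; the integral exists. *)
Theorem theorem5p5 (R : realType) (a b : R) (hs : a ^+ 2 + b ^+ 2 < 4) :
  (@areaR R).-integrable (@diskR R) (fun p => (pow_re a b p)%:E) /\
  (@areaR R).-integrable (@diskR R) (fun p => (pow_im a b p)%:E) /\
  pi^-1 * Rintegral (@areaR R) (@diskR R) (pow_re a b)
    = expR (S_re (complex.Complex a b)) * cos (S_im (complex.Complex a b)) /\
  pi^-1 * Rintegral (@areaR R) (@diskR R) (pow_im a b)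
    = expR (S_re (complex.Complex a b)) * sin (S_im (complex.Complex a b)).
Proof.
have [ir [ii e]] := areal_zeta_mahler a b hs.
by split => //; split => //; case: e.
Qed.
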